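(* Let $\omega\in\mathbb{R}\setminus\mathbb{Q}$ and $\lambda=e^{2\pi i\omega}$. Assume that there exist infinitely many odd integers $k>0$ such that $|\lambda^k-1|^{-1}\ge k!$. Then, for any $\Delta>0$, the generic $F$ in $\mathscr F_\omega^{\Delta}$ has a divergent foliation involution $\tau_F$.
   Context: $\mathbb{R}^2\cong\mathbb{C}$. $\mathscr{F}_\omega$ is the set of formal diffeomorphisms $F(z)=\lambda z+\sum_{j+k\ge2}F_{jk}z^j\bar z^k$, $F_{jk}\in\mathbb{C}$; $z,\bar z$ are treated as independent indeterminates, the conjugate of $F$ is $\tilde F=\overline{F}=\bar\lambda\bar z+\sum\overline{F_{jk}}\,z^k\bar z^j$, and $L\circ F$ means substituting $(z,\bar z)\mapsto(F,\overline F)$ in $L$. The complex extension of $F$ is $\hat F(z,w)=(F(z,w),\tilde F(z,w))$, obtained by replacing $\bar z$ with an independent variable $w$. For $\Delta>0$, $\mathscr{F}_\omega^{\Delta}$ is the set of analytic $F\in\mathscr F_\omega$ whose complex extension $\hat F$ is holomorphic in $\{|z|<\Delta,|w|<\Delta\}$, with the compact-open topology; a property is generic if it holds on a dense $G_\delta$ subset. $\mathscr L$ is the set of formal series $L(z)=z\bar z+\sum_{r+s\ge3}L_{rs}z^r\bar z^s$ with $L_{rs}=\overline{L_{sr}}\in\mathbb{C}$, and $L(z,w)=zw+\sum L_{rs}z^rw^s$ is its complex extension. $\mathscr G$ is the group (under composition) of formal series $R+\sum_{n\ge2}\Gamma_nR^n$, $\Gamma_n\in\mathbb{R}$. $L\in\mathscr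 L$ is called $F$-admissible if there is $\Gamma\in\mathscr G$ with $L\circ F=\Gamma\circ L$; such $L$ exist for every $F\in\mathscr F_\omega$, and any two differ by left composition with an element of $\mathscr G$. The foliation involution $\tau_F$ of $F$ is the unique formal involution $\tau_F(z)=-z+O(z^2)\in\mathbb{R}[[z]]$ such that $L(\tau_F(z),\tau_F(z))=L(z,z)$ for one (equivalently every) $F$-admissible $L$. It is divergent if its radius of convergence is $0$. *)

(* Defs.v *)
From HB Require Import structures.
From mathcomp Require Import all_boot all_order all_algebra.
From mathcomp Require Import complex.
From mathcomp Require Import all_classical all_reals all_analysis.
From mathcomp Require Import borel_hierarchy.

Set Implicit Arguments.
Unset Strict Implicit.
Unset Printing Implicit Defensive.

Import Order.TTheory GRing.Theory Num.Theory.
Import numFieldNormedType.Exports.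

Local Open Scope classical_set_scope.
Local Open Scope ring_scope.

(* R[i] itself is not keyed on a numFieldType, hence the alias: the library
   attaches a topology and a normed module structure to its elements. *)
Definition Cplx (R : realType) : numClosedFieldType := R[i].

(* Formal power series are represented by their coefficients: A n is the
   coefficient of z^n, and A j k that of z^j zbar^k (equivalently z^j w^k). *)
Definition fps1 (K : Type) : Type := nat -> K.
Definition fps2 (K : Type) : Type := nat -> nat -> K.

Section FormalSeries.
Variable K : comNzRingType.

Definition X1 : fps1 K := fun n => (n == 1%N)%:R.

Definition mul1 (A B : fps1 K) : fps1 K :=
  fun n => \sum_(a < n.+1) A a * B (n - a)%N.

Definition exp1 (A : fps1 K) (m : nat) : fps1 K :=
  iter m (mul1 A) (fun n => (n == 0%N)%:R).

Definition mul2 (A B : fps2 K) : fps2 K :=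
  fun j k => \sum_(a < j.+1) \sum_(b < k.+1) A a b * B (j - a)%N (k - b)%N.

Definition exp2 (A : fps2 K) (m : nat) : fps2 K :=
  iter m (mul2 A) (fun j k => ((j == 0%N) && (k == 0%N))%:R).

(* In the substitutions below, the substituted series are meant to have no
   constant term: the powers left out by the finite bounds then contribute
   nothing to the coefficient at hand. *)

(* A(B(z)) *)
Definition comp11 (A B : fps1 K) : fps1 K :=
  fun n => \sum_(m < n.+1) A m * exp1 B m n.

(* A(B(z, zbar)) *)
Definition comp12 (A : fps1 K) (B : fps2 K) : fps2 K :=
  fun j k => \sum_(m < (j + k).+1) A m * exp2 B m j k.

(* A(B(z), C(z)) *)
Definition comp21 (A : fps2 K) (B C : fps1 K) : fps1 K :=
  fun n => \sum_(r < n.+1) \sum_(s < n.+1)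
    A r s * mul1 (exp1 B r) (exp1 C s) n.

(* A(B(z, zbar), C(z, zbar)) *)
Definition comp22 (A B C : fps2 K) : fps2 K :=
  fun j k => \sum_(r < (j + k).+1) \sum_(s < (j + k).+1)
    A r s * mul2 (exp2 B r) (exp2 C s) j k.

End FormalSeries.

Section FoliationInvolution.
Variable R : realType.
Local Notation C := (Cplx R).

Definition of_real (a : fps1 R) : fps1 C := fun n => real_complex R (a n).

(* e^{2 pi i omega} *)
Definition multiplier (omega : R) : C :=
  Complex (cos (2 * pi * omega)) (sin (2 * pi * omega)).

Definition conj_fps (F : fps2 C) : fps2 C := fun j k => (F k j)^*.

Definition formal_diffeo (omega : R) : set (fps2 C) :=
  [set F | [/\ F 0%N 0%N = 0, F 1%N 0%N = multiplier omega & F 0%N 1%N = 0]].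

Definition scriptL : set (fps2 C) :=
  [set L | [/\ forall r s, L r s = (L s r)^*,
               L 0%N 0%N = 0,
               L 1%N 0%N = 0 /\ L 0%N 1%N = 0
             & [/\ L 2%N 0%N = 0, L 1%N 1%N = 1 & L 0%N 2%N = 0]]].

Definition scriptG : set (fps1 R) :=
  [set Gamma | Gamma 0%N = 0 /\ Gamma 1%N = 1].

Definition admissible (F L : fps2 C) : Prop :=
  scriptL L /\ exists2 Gamma, scriptG Gamma &
    comp22 L F (conj_fps F) = comp12 (of_real Gamma) L.

Definition foliation_involution (F : fps2 C) (tau : fps1 R) : Prop :=
  [/\ tau 0%N = 0 /\ tau 1%N = -1,
      comp11 tau tau = X1 R
    & exists2 L, admissible F L &
        comp21 L (of_real tau) (of_real tau) = comp21 L (X1 C) (X1 C)].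

Definition convergence_radius (a : fps1 R) : \bar R :=
  ereal_sup [set `|x|%:E | x in [set x : R | cvgn (pseries a x)]].

Definition divergent (a : fps1 R) : Prop := convergence_radius a = 0%E.

Definition has_divergent_involution (F : fps2 C) : Prop :=
  exists2 tau, foliation_involution F tau & divergent tau.

End FoliationInvolution.

Section AnalyticDiffeomorphisms.
Variable R : realType.
Local Notation C := (Cplx R).

Definition bidisc (Delta : R) : set (C * C) :=
  [set p | `|p.1| < real_complex R Delta /\ `|p.2| < real_complex R Delta].

Definition abs_convergent_at (A : fps2 C) (p : C * C) : Prop :=
  summable [set: nat * nat] (fun jk : nat * nat =>
    (ComplexField.Normc.normc (A jk.1 jk.2 * p.1 ^+ jk.1 * p.2 ^+ jk.2))%:E).

Definition fps_sum (A : fps2 C) (p : C * C) : C :=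
  limn (fun n : nat => \sum_(j < n) \sum_(k < n) A j k * p.1 ^+ j * p.2 ^+ k).

Definition complex_extension (F : fps2 C) (p : C * C) : C * C :=
  (fps_sum F p, fps_sum (conj_fps F) p).

(* Differentiability is that of a map between normed spaces over the field C,
   that is, complex differentiability. *)
Definition extension_holomorphic (Delta : R) (F : fps2 C) : Prop :=
  forall p : C * C, bidisc Delta p ->
    [/\ abs_convergent_at F p, abs_convergent_at (conj_fps F) p
      & differentiable (complex_extension F) p].

Definition analytic_diffeo (omega Delta : R) : set (fps2 C) :=
  formal_diffeo omega `&` extension_holomorphic Delta.

Definition restricted_extension (omega Delta : R)
    (F : analytic_diffeo omega Delta) :
    {compact-open, bidisc Delta -> (C * C)%type} :=
  fun p => complex_extension (val F) (val p).

Definition analytic_diffeo_space (omega Delta : R) : topologicalType :=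
  initial_topology (@restricted_extension omega Delta).

Definition series_of (omega Delta : R)
    (F : analytic_diffeo_space omega Delta) : fps2 C :=
  val (F : analytic_diffeo omega Delta).

End AnalyticDiffeomorphisms.

Definition generic (T : topologicalType) (P : set T) : Prop :=
  exists A : set T, [/\ Gdelta A, dense A & A `<=` P].

(* Main.v *)
Require Import Defs.
From mathcomp Require Import all_boot all_order all_algebra.
From mathcomp Require Import complex.
From mathcomp Require Import all_classical all_reals all_analysis.
From mathcomp Require Import cyclic separable cyclotomic.
From mathcomp Require Import zify ring lra.

(** Divergence comes from small divisors. Write [lam] for [e^{2 pi i omega}]
    and solve [L o F = Gamma o L] degree by degree. Once all data are known
    below degree [n], the coefficient of [z^j w^k], [j + k = n], of the equation
    involves the unknowns only through
    [(lam^j conj(lam)^k - 1) L_jk - (Gamma_j if j = k)], and the part of degree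
    [n - 1] of [F] only through [conj(lam) w F + lam z conj(F)]; this is
    [conjugacy_defect_diff]. As [lam] is not a root of unity, there is exactly
    one solution with [L_jj = 0] for [j >= 2]; its off-diagonal coefficients are
    obtained by division by [lam^(j-k) - 1], and uniqueness makes it real.

    The restriction [ell(x) = L(x, x) = x^2 + ...] is a real series, and the
    foliation involution is its deck involution, the only [tau = - x + ...] with
    [ell o tau = ell]. For even [q], changing [ell] in degree [q + 1] changes
    [tau_q] by the opposite amount ([deck_diff_even]). Consequently, adding
    [delta * conj(z)^q] to [F] leaves the coefficients of [tau] below [q]
    unchanged and moves [tau_q] by [2 Re (lam conj(delta) / (lam^(q+1) - 1))]
    ([involution_of_perturbation]): the perturbation is amplified by the small
    divisor of order [q + 1].

    For the generic statement, take the intersection over all integers [M] of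
    the sets of those [F] for which some coefficient satisfies
    [|tau_n| > M^(n+1)]; it consists of maps with divergent involution. Each of
    these sets is open: [tau_n] depends continuously on finitely many
    coefficients of [F] ([cvg_involution_of]), which are continuous for the
    compact-open topology by Cauchy's estimate ([coef_continuous]).

    The intersection is dense by an explicit construction, which avoids any
    completeness argument. Given [F] and [e > 0], subtract from [F] a
    series [sum_q s_q delta_q conj(z)^q], where [q + 1] runs through the odd
    integers with [|lam^(q+1) - 1|^-1 >= (q+1)!], where [|delta_q| = e t^q] for a
    fixed small [t], with the phase of [delta_q] chosen so that it moves [tau_q]
    by [2 e t^q / |lam^(q+1) - 1|], and [s_q] is 0 or 1. The two values of [s_q]
    give values of [tau_q] at distance at least [2 e t^q (q+1)!], so that one of
    them satisfies [|tau_q| >= e t^q (q+1)!]; since [tau_q] depends on [s_i] for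
    [i <= q] only, the [s_q] can be chosen one after the other
    ([binary_choice]). The resulting map is still analytic on the bidisc,
    uniformly [2 e]-close to [F] there, and its involution has coefficients that
    outgrow every geometric sequence ([divergent_nearby]). *)

Set Implicit Arguments.
Unset Strict Implicit.
Unset Printing Implicit Defensive.

Import Order.TTheory GRing.Theory Num.Theory.
Import numFieldNormedType.Exports.

Local Open Scope classical_set_scope.
Local Open Scope ring_scope.

(** * Series in two variables, filtered by total degree *)

Arguments exp2 : simpl never.
Arguments exp1 : simpl never.

Section TwoVariables.
Variable K : comNzRingType.
Implicit Types A B : fps2 K.

Definition ord2 n A := forall j k, (j + k < n)%N -> A j k = 0.
Definition agree2 n A B := forall j k, (j + k < n)%N -> A j k = B j k.
Definition sub2 A B : fps2 K := fun j k => A j k - B j k.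
Definition mono2 (c : K) j0 k0 : fps2 K :=
  fun j k => if (j == j0) && (k == k0) then c else 0.

Lemma agree2W m n A B : (m <= n)%N -> agree2 n A B -> agree2 m A B.
Proof. by move=> mn H j k jk; apply: H; apply: leq_trans mn. Qed.

Lemma agree2_ord n m A B : (m <= n)%N -> agree2 n A B -> ord2 m B -> ord2 m A.
Proof. by move=> mn H o j k jk; rewrite H ?o//; apply: leq_trans mn. Qed.

Lemma ord2_sub n A B : agree2 n A B -> ord2 n (sub2 A B).
Proof. by move=> H j k jk; rewrite /sub2 H// subrr. Qed.

Lemma mul2_eq A A' B B' j k :
  (forall a b, (a <= j)%N -> (b <= k)%N -> A a b = A' a b) ->
  (forall a b, (a <= j)%N -> (b <= k)%N -> B a b = B' a b) ->
  mul2 A B j k = mul2 A' B' j k.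
Proof.
move=> hA hB; apply: eq_bigr => a _; apply: eq_bigr => b _.
by rewrite hA ?hB ?leq_subr// -ltnS.
Qed.

Lemma mul2C A B j k : mul2 A B j k = mul2 B A j k.
Proof.
rewrite /mul2 (reindex_inj rev_ord_inj)/=; apply: eq_bigr => a _.
rewrite (reindex_inj rev_ord_inj)/=; apply: eq_bigr => b _.
by rewrite !subSS mulrC !subKn// -ltnS.
Qed.

(** The two factors are changed one at a time; this is how agreement of factors
    up to some degree passes to products. *)
Lemma mul2_telescope A A' B B' j k :
  mul2 A B j k - mul2 A' B' j k =
  mul2 (sub2 A A') B j k + mul2 A' (sub2 B B') j k.
Proof.
rewrite /mul2 -sumrB -big_split; apply: eq_bigr => a _ /=.
rewrite -sumrB -big_split; apply: eq_bigr => b _ /=.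
by rewrite /sub2; ring.
Qed.

Lemma mul2_ord a b A B : ord2 a A -> ord2 b B -> ord2 (a + b) (mul2 A B).
Proof.
move=> oA oB j k jk; rewrite /mul2 big1// => i _; rewrite big1// => l _.
have [h|h] := ltnP (i + l) a; first by rewrite oA ?mul0r.
by rewrite oB ?mulr0//; have := ltn_ord i; have := ltn_ord l; lia.
Qed.

(** A change of [A] in degree at least [p] is multiplied by [B], which has order
    at least [b], and symmetrically: products gain precision. *)
Lemma mul2_agree a b p q A A' B B' :
  ord2 a A' -> ord2 b B -> agree2 p A A' -> agree2 q B B' ->
  agree2 (minn (p + b) (a + q)) (mul2 A B) (mul2 A' B').
Proof.
move=> oA oB hA hB j k; rewrite leq_min => /andP[h1 h2].
apply/eqP; rewrite -subr_eq0 mul2_telescope.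
rewrite (mul2_ord (ord2_sub hA) oB)// (mul2_ord oA (ord2_sub hB))//.
by rewrite addr0.
Qed.

Lemma mul2_monol c j0 k0 B j k :
  mul2 (mono2 c j0 k0) B j k =
  if (j0 <= j)%N && (k0 <= k)%N then c * B (j - j0)%N (k - k0)%N else 0.
Proof.
rewrite /mul2 /mono2; case: ifPn => [/andP[hj hk]|h].
  rewrite (bigD1 (inord j0))//= inordK ?ltnS// [X in _ + X]big1 ?addr0; last first.
    move=> i /eqP hi; rewrite big1// => l _.
    case: ifP => [/andP[/eqP hh _]|_]; last by rewrite mul0r.
    by case: hi; apply/val_inj; rewrite /= inordK.
  rewrite (bigD1 (inord k0))//= inordK ?ltnS// [X in _ + X]big1 ?addr0 ?eqxx//.
  move=> l /eqP hl; rewrite andTb.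
  case: ifP => [/eqP hh|_]; last by rewrite mul0r.
  by case: hl; apply/val_inj; rewrite /= inordK.
rewrite big1// => i _; rewrite big1// => l _.
case: ifP => [/andP[/eqP hi /eqP hl]|_]; last by rewrite mul0r.
by move: h; rewrite -hi -hl !leq_ord.
Qed.

Lemma mul2_mono c d a b a' b' j k :
  mul2 (mono2 c a b) (mono2 d a' b') j k =
  mono2 (c * d) (a + a')%N (b + b')%N j k.
Proof.
rewrite mul2_monol /mono2; case: ifPn => [/andP[hj hk]|h].
  have -> : (j - a == a')%N = (j == a + a')%N by lia.
  have -> : (k - b == b')%N = (k == b + b')%N by lia.
  by case: ifP; rewrite ?mulr0.
by case: ifP => // /andP[]; lia.
Qed.

Lemma exp2_0 A : exp2 A 0 = mono2 1 0 0.
Proof.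
apply/funext => j; apply/funext => k.
by rewrite /exp2/= /mono2; case: ifP.
Qed.

Lemma mul2_1r A j k : mul2 A (mono2 1 0 0) j k = A j k.
Proof. by rewrite mul2C mul2_monol/= mul1r !subn0. Qed.

Lemma exp2S A m : exp2 A m.+1 = mul2 A (exp2 A m).
Proof. by []. Qed.

Lemma exp2_1 A : exp2 A 1 = A.
Proof.
apply/funext => j; apply/funext => k.
by rewrite exp2S exp2_0 mul2_1r.
Qed.

Lemma exp2_mono c a b m j k :
  exp2 (mono2 c a b) m j k = mono2 (c ^+ m) (a * m)%N (b * m)%N j k.
Proof.
elim: m j k => [|m IH] j k; first by rewrite exp2_0 !muln0.
rewrite exp2S !mulnS exprS -mul2_mono.
by apply: mul2_eq => // *; apply: IH.
Qed.

Lemma exp2_ord a m A : ord2 a A -> ord2 (a * m) (exp2 A m).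
Proof.
move=> oA; elim: m => [|m IH]; first by rewrite muln0.
by rewrite mulnS; apply: mul2_ord.
Qed.

(** Each extra factor has order [a], hence raises by [a] the degree up to which
    the powers agree; with [a = 2] this applies to [L], with [a = 1] to [F]. *)
Lemma exp2_agree a p m A A' : ord2 a A -> ord2 a A' -> agree2 p A A' ->
  agree2 (p + a * m.-1) (exp2 A m) (exp2 A' m).
Proof.
move=> oA oA' hA; case: m => [|m]; first by rewrite !exp2_0.
rewrite -pred_Sn.
elim: m => [|m IH]; first by rewrite !exp2_1 muln0 addn0.
have := mul2_agree oA' (@exp2_ord _ m.+1 _ oA) hA IH.
by apply: agree2W; rewrite mulnS; lia.
Qed.

Definition linear_part (lam mu : K) (F G : fps2 K) :=
  agree2 2 F (mono2 lam 1 0) /\ agree2 2 G (mono2 mu 0 1).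

Lemma mono2_ord c j0 k0 n : (n <= j0 + k0)%N -> ord2 n (mono2 c j0 k0).
Proof.
by move=> h j k jk; rewrite /mono2; case: ifP => // /andP[/eqP jj /eqP kk]; lia.
Qed.

Lemma linear_part_ord lam mu F G : linear_part lam mu F G ->
  ord2 1 F /\ ord2 1 G.
Proof.
by case=> hF hG; split; [apply: agree2_ord hF _|apply: agree2_ord hG _];
  rewrite //; apply: mono2_ord.
Qed.

(** The leading form of [F^r G^s] comes from the linear parts alone. *)
Lemma linear_part_leading lam mu F G r s : linear_part lam mu F G ->
  agree2 (r + s).+1 (mul2 (exp2 F r) (exp2 G s)) (mono2 (lam ^+ r * mu ^+ s) r s).
Proof.
move=> hFG; have [oF oG] := linear_part_ord hFG; case: hFG => hF hG.
have oX : ord2 1 (mono2 lam 1 0) by apply: mono2_ord.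
have oY : ord2 1 (mono2 mu 0 1) by apply: mono2_ord.
have pF : agree2 r.+1 (exp2 F r) (exp2 (mono2 lam 1 0) r).
  have := exp2_agree (m := r) oF oX hF; apply: agree2W; lia.
have pG : agree2 s.+1 (exp2 G s) (exp2 (mono2 mu 0 1) s).
  have := exp2_agree (m := s) oG oY hG; apply: agree2W; lia.
have H := mul2_agree (exp2_ord (m := r) oX) (exp2_ord (m := s) oG) pF pG.
have {}H : agree2 (r + s).+1 (mul2 (exp2 F r) (exp2 G s))
    (mul2 (exp2 (mono2 lam 1 0) r) (exp2 (mono2 mu 0 1) s)).
  by apply: agree2W H; lia.
move=> j k jk; rewrite H//.
have -> : mono2 (lam ^+ r * mu ^+ s) r s j k =
  mul2 (mono2 (lam ^+ r) r 0) (mono2 (mu ^+ s) 0 s) j k.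
  by rewrite mul2_mono addn0.
by apply: mul2_eq => a b _ _; rewrite exp2_mono !mul0n mul1n.
Qed.

Lemma linear_part_mul_ord lam mu F G r s : linear_part lam mu F G ->
  ord2 (r + s) (mul2 (exp2 F r) (exp2 G s)).
Proof.
move=> hFG; apply: (agree2_ord _ (linear_part_leading hFG)) => //.
exact: mono2_ord.
Qed.

(** Where two series first differ, the substitution of [(F, G)] sees only the
    linear parts of [F] and [G], which act diagonally on monomials. *)
Lemma comp22_agree_coef lam mu F G L L' j k : linear_part lam mu F G ->
  agree2 (j + k) L L' ->
  comp22 L F G j k - comp22 L' F G j k =
  lam ^+ j * mu ^+ k * (L j k - L' j k).
Proof.
move=> hFG hL; rewrite /comp22 -sumrB.
under eq_bigr => r _.
  rewrite -sumrB; under eq_bigr => s _ do rewrite -mulrBl.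
  over.
have oj : (j < (j + k).+1)%N by lia.
have ok : (k < (j + k).+1)%N by lia.
have z r s : (r, s) != (j, k) ->
    (L r s - L' r s) * mul2 (exp2 F r) (exp2 G s) j k = 0.
  move=> rs; have [h|h|h] := ltngtP (r + s)%N (j + k)%N.
  - by rewrite hL// subrr mul0r.
  - by rewrite (linear_part_mul_ord hFG)// mulr0.
  - rewrite (linear_part_leading hFG) ?h// /mono2.
    case: ifP => [/andP[/eqP jr /eqP ks]|_]; last by rewrite mulr0.
    by rewrite jr ks eqxx in rs.
rewrite (bigD1 (Ordinal oj))//= [X in _ + X]big1 ?addr0; last first.
  move=> r /eqP rj; rewrite big1// => s _; apply: z.
  by apply/eqP => -[e _]; apply: rj; apply/val_inj.
rewrite (bigD1 (Ordinal ok))//= [X in _ + X]big1 ?addr0; last first.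
  move=> s /eqP sk; apply: z.
  by apply/eqP => -[e]; apply: sk; apply/val_inj.
by rewrite (linear_part_leading hFG)// /mono2 !eqxx /= mulrC.
Qed.

Definition quadratic_part (L : fps2 K) := agree2 3 L (mono2 1 1 1).

Definition shift_z (A : fps2 K) j k := if j is j'.+1 then A j' k else 0.
Definition shift_w (A : fps2 K) j k := if k is k'.+1 then A j k' else 0.

(** For [r + s >= 3], the product [F^r G^s] determines in degree [n] only what
    [F] and [G] are below degree [n - 1]; only the term [z w] of [L] sees their
    parts of degree [n - 1], and there it is linear. *)
Lemma comp22_agree_subst lam mu F F' G G' L j k :
  linear_part lam mu F G -> linear_part lam mu F' G' -> quadratic_part L ->
  agree2 (j + k).-1 F F' -> agree2 (j + k).-1 G G' ->
  comp22 L F G j k - comp22 L F' G' j k =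
  mu * shift_w (sub2 F F') j k + lam * shift_z (sub2 G G') j k.
Proof.
move=> hFG hFG' hL aF aG.
have [oF oG] := linear_part_ord hFG.
have [oF' oG'] := linear_part_ord hFG'.
have z r s : (r, s) != (1, 1)%N -> (r < (j + k).+1)%N ->
    L r s * mul2 (exp2 F r) (exp2 G s) j k =
    L r s * mul2 (exp2 F' r) (exp2 G' s) j k.
  move=> rs _; have [h|h] := ltnP (r + s) 3.
    rewrite hL// /mono2; case: ifP => [/andP[/eqP r1 /eqP s1]|_].
      by rewrite r1 s1 eqxx in rs.
    by rewrite !mul0r.
  congr (_ * _).
  have pF := exp2_agree (m := r) oF oF' aF.
  have pG := exp2_agree (m := s) oG oG' aG.
  have := mul2_agree (exp2_ord (m := r) oF') (exp2_ord (m := s) oG) pF pG.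
  case: r s h rs pF pG => [|r] [|s] //= h rs pF pG.
  - move=> _; apply: mul2_eq => // a b ja kb; rewrite pG//.
    lia.
  - move=> _; apply: mul2_eq => // a b ja kb; rewrite pF//.
    lia.
  - apply; lia.
rewrite /comp22.
case: (posnP (j + k)) => [jk0|jk0].
  have [ej ek] : j = 0%N /\ k = 0%N by lia.
  rewrite ej ek in z *; by rewrite !big_ord1 z// subrr /= !mulr0 addr0.
have o1 : (1 < (j + k).+1)%N by lia.
rewrite -sumrB (bigD1 (Ordinal o1))//= [X in _ + X]big1 ?addr0; last first.
  move=> r /eqP r1; rewrite -sumrB big1// => s _.
  rewrite z ?subrr//; apply/eqP => -[e _].
  by apply: r1; apply/val_inj.
rewrite -sumrB (bigD1 (Ordinal o1))//= [X in _ + X]big1 ?addr0; last first.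
  move=> s /eqP s1; rewrite z ?subrr//; apply/eqP => -[e].
  by apply: s1; apply/val_inj.
rewrite hL// /mono2 /= !mul1r !exp2_1 mul2_telescope; case: hFG hFG' => _ hG [hF _].
have oX : ord2 1 (mono2 lam 1 0) by apply: mono2_ord.
have oDF := ord2_sub aF; have oDG := ord2_sub aG.
congr (_ + _).
  have H := mul2_agree oDF oG (q := 2) (p := (j + k).+1)
    (fun _ _ _ => erefl _) hG.
  rewrite H; last by lia.
  rewrite mul2C mul2_monol /shift_w.
  by case: k {H jk0 z hL aF aG oDF oDG o1} => [|k]; rewrite ?mulr0//= subn0 subn1.
have H := mul2_agree oX oDG (p := 2) (q := (j + k).+1) hF
  (fun _ _ _ => erefl _).
rewrite H; last by lia.
rewrite mul2_monol /shift_z.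
by case: j {H jk0 z hL aF aG oDF oDG o1} => [|j]; rewrite ?mulr0//= subn0 subn1.
Qed.

(** Since [L] has order 2, the term [Gam_m L^m] with [m >= 2] involves only the
    coefficients of [L] of degree less than [n], and its first occurrence is
    [Gam_m (z w)^m] in degree [2 m]. *)
Lemma comp12_agree_coef (Gam Gam' : fps1 K) L L' j k :
  quadratic_part L -> quadratic_part L' -> agree2 (j + k) L L' ->
  Gam 0%N = 0 -> Gam' 0%N = 0 -> Gam 1%N = 1 -> Gam' 1%N = 1 ->
  (forall m, (m.*2 < j + k)%N -> Gam m = Gam' m) ->
  comp12 Gam L j k - comp12 Gam' L' j k =
  (L j k - L' j k) + (if j == k then Gam j - Gam' j else 0).
Proof.
move=> hL hL' aL G0 G0' G1 G1' aG.
have oQ : ord2 2 (mono2 (1 : K) 1 1) by apply: mono2_ord.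
have oL : ord2 2 L by apply: agree2_ord hL _.
have oL' : ord2 2 L' by apply: agree2_ord hL' _.
have -> : comp12 Gam L j k - comp12 Gam' L' j k =
   (\sum_(m < (j + k).+1) Gam m * (exp2 L m j k - exp2 L' m j k)) +
   \sum_(m < (j + k).+1) (Gam m - Gam' m) * exp2 L' m j k.
  by rewrite -sumrB -big_split; apply: eq_bigr => m _ /=; ring.
congr (_ + _).
  case: (posnP (j + k)) => [jk0|jk0].
    have [-> ->] : j = 0%N /\ k = 0%N by lia.
    by rewrite big_ord1 G0 mul0r oL ?oL'// subrr.
  have o1 : (1 < (j + k).+1)%N by lia.
  rewrite (bigD1 (Ordinal o1))//= [X in _ + X]big1 ?addr0; last first.
    move=> [m mlt] /eqP m1 /=; case: m mlt m1 => [|[|m]] mlt m1.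
    - by rewrite G0 mul0r.
    - by case: m1; apply/val_inj.
    - have H := exp2_agree (m := m.+2) oL oL' aL.
      by rewrite H ?subrr ?mulr0//=; lia.
  by rewrite G1 mul1r !exp2_1.
have z m : ~~ ((m == j) && (m == k)) -> (Gam m - Gam' m) * exp2 L' m j k = 0.
  move=> mjk; have [h|h] := ltnP m.*2 (j + k)%N; first by rewrite aG// subrr mul0r.
  case: m h mjk => [|m] h mjk; first by rewrite G0 G0' subrr mul0r.
  rewrite (exp2_agree (m := m.+1) oL' oQ hL'); last by lia.
  rewrite exp2_mono /mono2 !mul1n.
  case: ifP; rewrite ?mulr0// => /andP[/eqP jm /eqP km].
  by move: mjk; rewrite jm km !eqxx.
case: eqP => [jk|jk]; last by rewrite big1// => m _; apply: z; lia.
have oj : (j < (j + k).+1)%N by lia.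
rewrite (bigD1 (Ordinal oj))//= [X in _ + X]big1 ?addr0; last first.
  by move=> m /eqP mj; apply: z; apply/negP => /andP[/eqP e _]; apply: mj;
    apply/val_inj.
rewrite -jk; case: (posnP j) => [->|jp]; first by rewrite G0 G0' subrr mul0r.
rewrite (exp2_agree (m := j) oL' oQ hL'); last by lia.
by rewrite exp2_mono /mono2 !mul1n !eqxx expr1n mulr1.
Qed.

Definition conjugacy_defect (F G L : fps2 K) (Gam : fps1 K) : fps2 K :=
  fun j k => comp22 L F G j k - comp12 Gam L j k.

Definition normal_gamma (Gam : fps1 K) := Gam 0%N = 0 /\ Gam 1%N = 1.

(** The linearisation of the conjugacy equation at the first degree where the
    data differ. It serves three purposes: with [F = F'] it shows that the
    equation can be solved and that the solution is unique; with distinct [F] it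
    measures how a perturbation moves the solution. The small divisors are the
    factors [lam^j mu^k - 1]. *)
Lemma conjugacy_defect_diff lam mu F F' G G' L L' Gam Gam' j k :
  linear_part lam mu F G -> linear_part lam mu F' G' ->
  quadratic_part L -> quadratic_part L' ->
  normal_gamma Gam -> normal_gamma Gam' ->
  agree2 (j + k).-1 F F' -> agree2 (j + k).-1 G G' -> agree2 (j + k) L L' ->
  (forall m, (m.*2 < j + k)%N -> Gam m = Gam' m) ->
  conjugacy_defect F G L Gam j k - conjugacy_defect F' G' L' Gam' j k =
  (lam ^+ j * mu ^+ k - 1) * (L j k - L' j k)
  - (if j == k then Gam j - Gam' j else 0)
  + (mu * shift_w (sub2 F F') j k + lam * shift_z (sub2 G G') j k).
Proof.
move=> hFG hFG' hL hL' [G0 G1] [G0' G1'] aF aG aL aGam.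
rewrite /conjugacy_defect.
have H1 := comp22_agree_coef hFG aL.
have H2 := comp22_agree_subst hFG hFG' hL' aF aG.
have H3 := comp12_agree_coef hL hL' aL G0 G0' G1 G1' aGam.
transitivity ((comp22 L F G j k - comp22 L' F G j k)
  + (comp22 L' F G j k - comp22 L' F' G' j k)
  - (comp12 Gam L j k - comp12 Gam' L' j k)); first by ring.
by rewrite H1 H2 H3; ring.
Qed.

End TwoVariables.

(** * Solving equations degree by degree *)

Section CausalFixpoint.
Variables (X : Type) (Phi : (nat -> X) -> nat -> X) (x0 : nat -> X).
Hypothesis causal : forall n f g,
  (forall i, (i < n)%N -> f i = g i) -> Phi f n = Phi g n.

(** If the value of [Phi f] at [n] depends only on the values of [f] below [n],
    the value at [n] is settled after [n + 1] iterations. An explicit iterate,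
    rather than an abstract existence statement, lets continuity in parameters
    be proved by induction on the number of iterations. *)
Definition causal_fix n := iter n.+1 Phi x0 n.

Lemma iter_causal m m' n : (n < m)%N -> (n < m')%N ->
  iter m Phi x0 n = iter m' Phi x0 n.
Proof.
elim/ltn_ind: n m m' => n IH [|m] [|m'] // nm nm'.
by rewrite !iterS; apply: causal => i ni; apply: IH => //; lia.
Qed.

Lemma causal_fixE n : Phi causal_fix n = causal_fix n.
Proof.
rewrite [RHS]/causal_fix iterS; apply: causal => i ni.
by rewrite /causal_fix; apply: iter_causal; lia.
Qed.

End CausalFixpoint.

(** * The normalised solution of the conjugacy equation *)

Section LowDegree.
Variable K : comNzRingType.

Lemma comp22_mono11 (F G : fps2 K) j k : ord2 1 F -> ord2 1 G ->
  comp22 (mono2 1 1 1) F G j k = mul2 F G j k.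
Proof.
move=> oF oG; rewrite /comp22; case: (posnP (j + k)) => [jk0|jk0].
  rewrite (mul2_ord oF oG) ?jk0// !big_ord1 /mono2/= mul0r //.
have o1 : (1 < (j + k).+1)%N by lia.
rewrite (bigD1 (Ordinal o1))//= [X in _ + X]big1 ?addr0; last first.
  move=> r /eqP r1; rewrite big1// => s _; rewrite /mono2.
  case: ifP => [/andP[/eqP e _]|]; last by rewrite mul0r.
  by case: r1; apply/val_inj.
rewrite (bigD1 (Ordinal o1))//= [X in _ + X]big1 ?addr0; last first.
  move=> r /eqP r1; rewrite /mono2.
  case: ifP => [/andP[_ /eqP e]|]; last by rewrite mul0r.
  by case: r1; apply/val_inj.
by rewrite /mono2/= mul1r !exp2_1.
Qed.

Lemma comp12_X1 (L : fps2 K) j k : ord2 1 L -> comp12 (X1 K) L j k = L j k.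
Proof.
move=> oL; rewrite /comp12; case: (posnP (j + k)) => [jk0|jk0].
  by rewrite oL ?jk0// big_ord1 /X1 mul0r.
have o1 : (1 < (j + k).+1)%N by lia.
rewrite (bigD1 (Ordinal o1))//= [X in _ + X]big1 ?addr0; last first.
  move=> r /eqP r1; rewrite /X1; case: eqP => [e|_]; last by rewrite mul0r.
  by case: r1; apply/val_inj.
by rewrite /X1 mul1r exp2_1.
Qed.

Lemma shift_z_ord (A : fps2 K) n j k : ord2 n A -> (j + k <= n)%N ->
  shift_z A j k = 0.
Proof. by case: j => [|j]//= oA h; apply: oA; lia. Qed.

Lemma shift_w_ord (A : fps2 K) n j k : ord2 n A -> (j + k <= n)%N ->
  shift_w A j k = 0.
Proof. by case: k => [|k]//= oA h; apply: oA; lia. Qed.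

(** Below degree 3 the equation reads [lam mu z w = z w]. *)
Lemma conjugacy_defect_low lam mu (F G L : fps2 K) Gam j k : lam * mu = 1 ->
  linear_part lam mu F G -> quadratic_part L -> normal_gamma Gam ->
  (j + k < 3)%N -> conjugacy_defect F G L Gam j k = 0.
Proof.
move=> lm hFG hL hG jk.
have hFG' : linear_part lam mu (mono2 lam 1 0) (mono2 mu 0 1) by [].
have [oF oG] := linear_part_ord hFG'.
have hL' : quadratic_part (mono2 (1 : K) 1 1) by [].
have hG' : normal_gamma (X1 K) by [].
have := @conjugacy_defect_diff _ _ _ _ _ _ _ _ _ _ _ j k hFG hFG' hL hL' hG hG'.
case: hFG => hF hG2.
rewrite hL//= subrr mulr0 (shift_w_ord (ord2_sub hF))//.
rewrite (shift_z_ord (ord2_sub hG2))// !mulr0 addr0 addr0.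
have -> : (if j == k then Gam j - X1 K j else 0) = 0.
  case: eqP => // e; have : (j < 2)%N by lia.
  by case: j {e jk} => [|[|j]]//= _; rewrite /X1/= ?hG.1 ?hG.2 subrr.
rewrite subr0 => H.
have {}H : conjugacy_defect F G L Gam j k =
    conjugacy_defect (mono2 lam 1 0) (mono2 mu 0 1) (mono2 1 1 1) (X1 K) j k.
  apply/eqP; rewrite -subr_eq0; apply/eqP; apply: H.
  - by apply: agree2W hF; lia.
  - by apply: agree2W hG2; lia.
  - by apply: agree2W hL; lia.
  - move=> m mjk; have : (m < 2)%N by lia.
    by case: m {mjk} => [|[|m]]//= _; rewrite /X1/= ?hG.1 ?hG.2.
rewrite H /conjugacy_defect comp22_mono11// comp12_X1; last exact: mono2_ord.
by rewrite mul2_mono lm subrr.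
Qed.

End LowDegree.

Section Normalisation.
Variable K : fieldType.
Variables lam mu : K.
Hypothesis lammu : lam * mu = 1.
Hypothesis nonres : forall j k, j != k -> lam ^+ j * mu ^+ k - 1 != 0.
Implicit Types F G L : fps2 K.

(** The solutions of the conjugacy equation are unique up to left composition of
    [L] with a real series tangent to the identity; the condition on the
    diagonal coefficients removes this freedom. *)
Definition normalised F G L (Gam : fps1 K) :=
  [/\ quadratic_part L, normal_gamma Gam, forall j, (1 < j)%N -> L j j = 0
    & forall j k, conjugacy_defect F G L Gam j k = 0].

Lemma normalised_diff F F' G G' L L' Gam Gam' j k :
  linear_part lam mu F G -> linear_part lam mu F' G' ->
  normalised F G L Gam -> normalised F' G' L' Gam' ->
  agree2 (j + k).-1 F F' -> agree2 (j + k).-1 G G' -> agree2 (j + k) L L' ->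
  (forall m, (m.*2 < j + k)%N -> Gam m = Gam' m) ->
  (lam ^+ j * mu ^+ k - 1) * (L j k - L' j k) =
  (if j == k then Gam j - Gam' j else 0)
  - (mu * shift_w (sub2 F F') j k + lam * shift_z (sub2 G G') j k).
Proof.
move=> hFG hFG' [hL hG _ E] [hL' hG' _ E'] aF aG aL aGam.
have := conjugacy_defect_diff hFG hFG' hL hL' hG hG' aF aG aL aGam.
rewrite E E' subrr => /esym/eqP; rewrite addr_eq0 subr_eq => /eqP ->.
by rewrite addrC.
Qed.

(** Both off-diagonal coefficients of [L] and coefficients of [Gam] are
    determined in turn, by the nonresonance condition and by [lam mu = 1]
    respectively. For [F = F'] this is uniqueness. *)
Lemma normalised_agree p F F' G G' L L' Gam Gam' :
  linear_part lam mu F G -> linear_part lam mu F' G' ->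
  normalised F G L Gam -> normalised F' G' L' Gam' ->
  agree2 p F F' -> agree2 p G G' ->
  agree2 p.+1 L L' /\ forall m, (m.*2 < p.+1)%N -> Gam m = Gam' m.
Proof.
move=> hFG hFG' admissible_series nL' aF aG.
suff H d : (d <= p.+1)%N -> agree2 d L L' /\
    forall m, (m.*2 < d)%N -> Gam m = Gam' m by exact: H.
elim: d => [|d IH] dp; first by split => [j k|m].
have [aL aGam] := IH (ltnW dp).
have H j k : (j + k = d)%N -> (lam ^+ j * mu ^+ k - 1) * (L j k - L' j k) =
    (if j == k then Gam j - Gam' j else 0).
  move=> jk; rewrite (normalised_diff hFG hFG' admissible_series nL').
  - rewrite (shift_w_ord (ord2_sub aF)); last by lia.
    by rewrite (shift_z_ord (ord2_sub aG)) ?mulr0 ?addr0 ?subr0//; lia.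
  - by apply: agree2W aF; lia.
  - by apply: agree2W aG; lia.
  - by rewrite jk.
  - by rewrite jk.
split.
  move=> j k jk; have [h|h] := ltnP (j + k) d; first exact: aL.
  have {h jk} jk : (j + k = d)%N by lia.
  case: (eqVneq j k) => [e|e].
    subst k; case: admissible_series nL' => hL _ z _ [hL' _ z' _].
    case: (ltnP 1 j) => j1; first by rewrite z ?z'.
    by rewrite hL ?hL'//; lia.
  have := H _ _ jk; rewrite (negPf e) => /eqP.
  by rewrite mulf_eq0 (negPf (nonres e)) subr_eq0 => /eqP.
move=> m md; have [h|h] := ltnP m.*2 d; first exact: aGam.
have {h md} md : (m + m = d)%N by lia.
have := H _ _ md; rewrite eqxx -exprMn lammu expr1n subrr mul0r.
by move/esym/eqP; rewrite subr_eq0 => /eqP.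
Qed.

Section Existence.
Variables F G : fps2 K.
Hypothesis hFG : linear_part lam mu F G.

(** The unknowns arranged by degree: at [d], the coefficients [L_j,(d-j)] as a
    function of [j], and [Gam_(d/2)]. *)
Definition state := nat -> (nat -> K) * K.

Definition state_L (f : state) : fps2 K := fun j k =>
  if (j + k < 3)%N then mono2 1 1 1 j k
  else if j == k then 0 else (f (j + k)%N).1 j.

Definition state_Gam (f : state) : fps1 K := fun m =>
  if (m < 2)%N then X1 K m else (f m.*2).2.

(** One correction of every unknown by the defect it is responsible for, divided
    by its coefficient in the linearised equation; a fixed point therefore
    solves the equation. Unknowns fixed by the normalisation are sent to the
    junk value 0, which makes the step depend on lower degrees only. *)
Definition newton_step (f : state) : state := fun d =>
  (fun j => if [&& 2 < d, j <= d & j != d - j]%N then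
     (f d).1 j - conjugacy_defect F G (state_L f) (state_Gam f) j (d - j)%N /
       (lam ^+ j * mu ^+ (d - j) - 1)
   else 0,
   if (2 < d)%N && ~~ odd d then
     (f d).2 + conjugacy_defect F G (state_L f) (state_Gam f) d./2 d./2
   else 0).

Lemma state_L_quadratic f : quadratic_part (state_L f).
Proof. by move=> j k jk; rewrite /state_L jk. Qed.

Lemma state_Gam_normal f : normal_gamma (state_Gam f).
Proof. by []. Qed.

(** The correction cancels the dependence on the unknowns of the current degree,
    by [conjugacy_defect_diff]. *)
Lemma newton_step_causal n f g : (forall i, (i < n)%N -> f i = g i) ->
  newton_step f n = newton_step g n.
Proof.
move=> fg.
have aL : agree2 n (state_L f) (state_L g).
  by move=> j k jk; rewrite /state_L fg.
have aGam m : (m.*2 < n)%N -> state_Gam f m = state_Gam g m.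
  by move=> mn; rewrite /state_Gam fg.
have E j k : (j + k = n)%N ->
    conjugacy_defect F G (state_L f) (state_Gam f) j k -
    conjugacy_defect F G (state_L g) (state_Gam g) j k =
    (lam ^+ j * mu ^+ k - 1) * (state_L f j k - state_L g j k)
    - (if j == k then state_Gam f j - state_Gam g j else 0).
  move=> jk; rewrite (conjugacy_defect_diff hFG hFG (state_L_quadratic f)
    (state_L_quadratic g) (state_Gam_normal f) (state_Gam_normal g))// ?jk//.
  have o A : ord2 n (sub2 A A : fps2 K) by apply: ord2_sub.
  by rewrite (shift_w_ord (o F)) ?(shift_z_ord (o G)) ?jk// !mulr0 !addr0.
rewrite /newton_step; congr pair.
  apply/funext => j; case: ifP => // /and3P[n2 jn jnj].
  have := E j (n - j)%N; rewrite subnKC// => /(_ erefl).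
  have SL h : state_L h j (n - j)%N = (h n).1 j.
    by rewrite /state_L subnKC// ltnNge n2/= (negPf jnj).
  rewrite (negPf jnj) subr0 !SL.
  move/(canRL (subrK _)) => ->; have := nonres jnj; set c := (_ - 1) => c0.
  by field.
case: ifP => // /andP[n2 en].
have n2E : (n./2 + n./2 = n)%N.
  by rewrite addnn -[RHS](odd_double_half n) (negPf en).
have SL h : state_L h n./2 n./2 = 0 by rewrite /state_L n2E ltnNge n2/= eqxx.
have SG h : state_Gam h n./2 = (h n).2.
  by rewrite /state_Gam ltnNge -addnn n2E; have -> : (1 < n./2)%N by lia.
have := E _ _ n2E; rewrite eqxx !SL !SG subrr mulr0 sub0r.
by move/(canRL (subrK _)) => ->; ring.
Qed.

Definition zero_state : state := fun=> (fun=> 0, 0).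
Definition normal_state := causal_fix newton_step zero_state.

(** Sealed, so that comparing the solutions for two maps never unfolds the
    recursion that defines them. *)
Fact normal_seal :
  {s : fps2 K * fps1 K | s = (state_L normal_state, state_Gam normal_state)}.
Proof. by eexists. Qed.

Definition normal_L := (sval normal_seal).1.
Definition normal_Gam := (sval normal_seal).2.

Lemma normal_LE : normal_L = state_L normal_state.
Proof. by rewrite /normal_L; case: normal_seal => s /= ->. Qed.

Lemma normal_GamE : normal_Gam = state_Gam normal_state.
Proof. by rewrite /normal_Gam; case: normal_seal => s /= ->. Qed.

Lemma normal_normalised : normalised F G normal_L normal_Gam.
Proof.
rewrite normal_LE normal_GamE.
have hL : quadratic_part (state_L normal_state) by apply: state_L_quadratic.
have hG : normal_gamma (state_Gam normal_state) by apply: state_Gam_normal.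
split => //.
  move=> j j1; rewrite /state_L eqxx ltnNge.
  by have -> : (2 < j + j)%N by lia.
move=> j k; have [h|h] := ltnP (j + k) 3.
  exact: (conjugacy_defect_low lammu hFG).
have := causal_fixE zero_state newton_step_causal (j + k).
case E : (causal_fix _ _ _) => [f c].
rewrite /newton_step h E /= => -[hf hc].
case: (eqVneq j k) => [e|e].
  move: hc; subst k; rewrite addnn odd_double doubleK/= => /eqP.
  by rewrite -subr_eq0 addrAC subrr add0r => /eqP.
move/(congr1 (@^~ j)) : hf; rewrite leq_addr addKn e /= => /eqP.
rewrite -subr_eq0 addrAC subrr add0r oppr_eq0 mulf_eq0 invr_eq0.
by rewrite (negPf (nonres e)) orbF => /eqP.
Qed.

End Existence.

End Normalisation.

(** * Series in one variable and restriction to the diagonal *)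

Section OneVariable.
Variable K : comNzRingType.
Implicit Types A B : fps1 K.

(** A series in [w] alone, seen as a series in [(z, w)]. The same embedding
    transfers the degree estimates to one variable, serves to sum power series,
    and provides the perturbations of [F]. *)
Definition emb_w A : fps2 K := fun j k => if j == 0%N then A k else 0.

Lemma mul2_emb A B j k : mul2 (emb_w A) (emb_w B) j k = emb_w (mul1 A B) j k.
Proof.
rewrite /mul2 /emb_w; case: j => [|j].
  by rewrite big_ord1 /mul1; apply: eq_bigr.
rewrite big1// => a _; rewrite big1// => b _; case: eqP => [->|_].
  by rewrite subn0 mulr0.
by rewrite mul0r.
Qed.

Lemma exp1S A m : exp1 A m.+1 = mul1 A (exp1 A m).
Proof. by []. Qed.

Lemma exp2_emb A m j k : exp2 (emb_w A) m j k = emb_w (exp1 A m) j k.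
Proof.
elim: m j k => [|m IH] j k.
  by rewrite /exp2/= /exp1/= /emb_w; case: eqP.
by rewrite exp2S exp1S -mul2_emb; apply: mul2_eq => // *; apply: IH.
Qed.

Lemma emb_ord n A : (forall k, (k < n)%N -> A k = 0) -> ord2 n (emb_w A).
Proof.
by move=> oA j k jk; rewrite /emb_w; case: eqP => // j0; apply: oA; lia.
Qed.

Lemma emb_agree n A B : (forall k, (k < n)%N -> A k = B k) ->
  agree2 n (emb_w A) (emb_w B).
Proof.
by move=> oA j k jk; rewrite /emb_w; case: eqP => // j0; apply: oA; lia.
Qed.

Lemma exp1_ord m n A : A 0%N = 0 -> (n < m)%N -> exp1 A m n = 0.
Proof.
move=> A0 nm; have oA : ord2 1 (emb_w A) by apply: emb_ord => -[].
by have := exp2_emb A m 0 n; rewrite (exp2_ord oA)// mul1n.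
Qed.

Lemma exp1_lead m A : A 0%N = 0 -> exp1 A m m = A 1%N ^+ m.
Proof.
move=> A0; have oA : ord2 1 (emb_w A) by apply: emb_ord => -[].
have oX : ord2 1 (mono2 (A 1%N) 0 1) by apply: mono2_ord.
have aA : agree2 2 (emb_w A) (mono2 (A 1%N) 0 1).
  by move=> [|[|j]] [|[|k]]//= _; rewrite /emb_w/= /mono2//= A0.
have := exp2_emb A m 0 m; rewrite (exp2_agree (m := m) oA oX aA); last by lia.
by rewrite exp2_mono /mono2 mul0n mul1n !eqxx /emb_w/=.
Qed.

Lemma exp1_agree p m n A B : A 0%N = 0 -> B 0%N = 0 ->
  (forall k, (k < p)%N -> A k = B k) -> (n < p + m.-1)%N ->
  exp1 A m n = exp1 B m n.
Proof.
move=> A0 B0 AB nm.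
have oA : ord2 1 (emb_w A) by apply: emb_ord => -[].
have oB : ord2 1 (emb_w B) by apply: emb_ord => -[].
have := exp2_emb A m 0 n; have := exp2_emb B m 0 n.
rewrite (exp2_agree (m := m) oA oB (emb_agree AB)) ?mul1n//.
by rewrite /emb_w/= => -> ->.
Qed.

(** One-variable counterpart of the linearisation: at the first degree where the
    data differ, [ell] only contributes through its leading term [x^2], whose
    derivative along [tau = c x + ...] is [2 c x]. *)
Lemma comp11_diff c q (ell ell' tau tau' : fps1 K) :
  (2 <= q)%N ->
  (forall m, (m < 2)%N -> ell m = 0) -> ell 2%N = 1 ->
  tau 0%N = 0 -> tau' 0%N = 0 -> tau 1%N = c -> tau' 1%N = c ->
  (forall m, (m <= q)%N -> ell m = ell' m) ->
  (forall m, (m < q)%N -> tau m = tau' m) ->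
  comp11 ell tau q.+1 - comp11 ell' tau' q.+1 =
  2 * c * (tau q - tau' q) + c ^+ q.+1 * (ell q.+1 - ell' q.+1).
Proof.
move=> q2 l01 l2 t0 t0' t1 t1' al atau.
have -> : comp11 ell tau q.+1 - comp11 ell' tau' q.+1 =
   \sum_(m < q.+2) ell m * (exp1 tau m q.+1 - exp1 tau' m q.+1) +
   \sum_(m < q.+2) (ell m - ell' m) * exp1 tau' m q.+1.
  by rewrite /comp11 -sumrB -big_split; apply: eq_bigr => m _ /=; ring.
congr (_ + _); last first.
  rewrite big_ord_recr big1 /= ?add0r; last first.
    by move=> m _; rewrite al ?subrr ?mul0r// -ltnS.
  by rewrite exp1_lead// t1' mulrC.
have o2 : (2 < q.+2)%N by lia.
rewrite (bigD1 (Ordinal o2))//= [X in _ + X]big1 ?addr0; last first.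
  move=> m /eqP m2; have [h|h] := ltnP m 2; first by rewrite l01// mul0r.
  rewrite (exp1_agree (p := q) t0 t0')// ?subrr ?mulr0//.
  suff : (m : nat) <> 2%N by lia.
  by move=> e; apply: m2; apply/val_inj.
rewrite l2 mul1r.
have E A : exp1 A 2 q.+1 = mul2 (emb_w A) (emb_w A) 0 q.+1.
  rewrite -[LHS]/(emb_w (exp1 A 2) 0 q.+1) -exp2_emb 2!exp2S exp2_0.
  by apply: mul2_eq => // a b _ _; rewrite mul2_1r.
have oA A : A 0%N = 0 -> ord2 1 (emb_w A) by move=> A0; apply: emb_ord => -[].
have lA A : A 0%N = 0 -> A 1%N = c -> agree2 2 (emb_w A) (mono2 c 0 1).
  move=> A0 A1; by move=> [|[|j]] [|[|k]]//= _; rewrite /emb_w/= /mono2//= A0.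
have D := ord2_sub (emb_agree atau).
rewrite !E mul2_telescope.
(* The difference has order q: in degree q + 1 the other factor only contributes
   its linear term. *)
have H1 := mul2_agree D (oA _ t0) (q := 2) (p := q.+2) (fun _ _ _ => erefl _)
  (lA _ t0 t1).
have oX : ord2 1 (mono2 c 0 1) by apply: mono2_ord.
have {}H2 := mul2_agree oX D (p := 2) (q := q.+2) (lA _ t0' t1')
  (fun _ _ _ => erefl _).
rewrite H1 ?H2; [|lia..].
rewrite mul2C !mul2_monol /= subn1 /sub2 /emb_w/=; ring.
Qed.

(** Associativity of composition and the law of exponents are inherited from
    polynomials through such truncations. *)
Definition approx N (P : {poly K}) A := forall i, (i < N)%N -> P`_i = A i.

Lemma approx_poly N A : approx N (\poly_(i < N) A i) A.
Proof. by move=> i iN; rewrite coef_poly iN. Qed.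

Lemma approx_mul N P Q A B : approx N P A -> approx N Q B ->
  approx N (P * Q) (mul1 A B).
Proof.
move=> hA hB n nN; rewrite coefM /mul1; apply: eq_bigr => i _.
by rewrite hA ?hB//; have := ltn_ord i; lia.
Qed.

Lemma approx_exp N P A m : approx N P A -> approx N (P ^+ m) (exp1 A m).
Proof.
move=> hA; elim: m => [|m IH].
  by move=> i _; rewrite expr0 coef1.
by rewrite exprS; apply: approx_mul.
Qed.

Lemma approx_comp N P Q A B : B 0%N = 0 -> approx N P A -> approx N Q B ->
  approx N (P \Po Q) (comp11 A B).
Proof.
move=> B0 hA hB n nN; rewrite comp_polyE coef_sum /comp11.
under eq_bigr do rewrite coefZ (approx_exp _ hB)//.
rewrite (big_ord_widen _ (fun i => P`_i * exp1 B i n) (leq_maxl _ n.+1)).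
rewrite (big_ord_widen _ (fun i => A i * exp1 B i n) (leq_maxr (size P) n.+1)).
rewrite big_mkcond [RHS]big_mkcond/=; apply: eq_bigr => i _.
case: ltnP => iP; case: ltnP => iN //.
- by rewrite hA//; lia.
- by rewrite exp1_ord ?mulr0.
- by rewrite -hA ?nth_default ?mul0r//; lia.
Qed.

Lemma approx_eq A B : (forall N, exists2 P, approx N P A & approx N P B) ->
  A = B.
Proof.
by move=> H; apply/funext => n; have [P PA PB] := H n.+1; rewrite -PA// PB.
Qed.

Lemma comp11_0 A B : comp11 A B 0%N = A 0%N.
Proof. by rewrite /comp11 big_ord1 mulr1. Qed.

Lemma comp11A A B D : B 0%N = 0 -> D 0%N = 0 ->
  comp11 (comp11 A B) D = comp11 A (comp11 B D).
Proof.
move=> B0 D0; apply: approx_eq => N.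
have aA := approx_poly (N := N) A; have aB := approx_poly (N := N) B.
have aD := approx_poly (N := N) D.
exists (((\poly_(i < N) A i) \Po (\poly_(i < N) B i)) \Po (\poly_(i < N) D i)).
  by do 2!apply: approx_comp => //.
rewrite -comp_polyA; apply: approx_comp => //; first by rewrite comp11_0.
exact: approx_comp.
Qed.

Lemma mul1_exp1 A r s : mul1 (exp1 A r) (exp1 A s) = exp1 A (r + s).
Proof.
apply: approx_eq => N; have aA := approx_poly (N:=N) A.
exists ((\poly_(i < N) A i) ^+ (r + s)); last exact: approx_exp.
by rewrite exprD; apply: approx_mul; apply: approx_exp.
Qed.

Lemma comp11_X1 A : comp11 A (X1 K) = A.
Proof.
apply: approx_eq => N; exists (\poly_(i < N) A i); last exact: approx_poly.
rewrite -[X in approx _ X]comp_polyXr; apply: approx_comp => //.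
  exact: approx_poly.
by move=> i _; rewrite coefX.
Qed.

Definition diagonal (L : fps2 K) : fps1 K :=
  fun n => \sum_(r < n.+1) L r (n - r)%N.

Lemma comp21_diagonal L B : B 0%N = 0 -> comp21 L B B = comp11 (diagonal L) B.
Proof.
move=> B0; apply/funext => n; rewrite /comp21 /comp11 /diagonal.
under eq_bigr do under eq_bigr do rewrite mul1_exp1.
under [RHS]eq_bigr => m _.
  rewrite mulr_suml (big_ord_widen n.+1 (fun r => L r (m - r)%N * exp1 B m n))//.
  over.
rewrite [RHS](exchange_big_dep xpredT)//=; apply: eq_bigr => r _.
rewrite -(big_mkord (fun m => r < m.+1)%N (fun m => L r (m - r)%N * exp1 B m n)).
rewrite (big_cat_nat (n := r))//=; last exact/ltnW.
rewrite [X in _ = X + _]big_nat_cond [X in _ = X + _]big1 ?add0r; last first.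
  by move=> i /andP[/andP[_ h1] h2]; lia.
rewrite -{3}[r : nat]add0n big_addn.
rewrite -(big_mkord xpredT (fun s => L r s * exp1 B (r + s) n)).
rewrite (big_cat_nat (n := (n.+1 - r)%N))//=; last exact: leq_subr.
rewrite [X in _ + X = _]big_nat_cond [X in _ + X = _]big1 ?addr0; last first.
  by move=> s /andP[/andP[h _] _]; rewrite exp1_ord ?mulr0//; lia.
rewrite [RHS]big_mkcond/=; apply: eq_bigr => s _.
by rewrite ltnS leq_addl addnK addnC.
Qed.

End OneVariable.

(** * The deck involution of a series x^2 + O(x^3) *)

Section Involution.
Variable R : realFieldType.
Implicit Types ell tau : fps1 R.

Definition quadratic_start ell := (forall m, (m < 2)%N -> ell m = 0) /\ ell 2%N = 1.

(** By [comp11_diff], the first coefficient where [rho] and [rho'] differ would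
    be visible in [ell o rho]. With [c = 1], this shows that [tau o tau] is the
    identity. *)
Lemma comp11_inj c ell rho rho' : quadratic_start ell -> c != 0 ->
  rho 0%N = 0 -> rho' 0%N = 0 -> rho 1%N = c -> rho' 1%N = c ->
  comp11 ell rho = comp11 ell rho' -> rho = rho'.
Proof.
move=> [l01 l2] c0 r0 r0' r1 r1' E; apply/funext => n.
elim/ltn_ind: n => -[|[|n]] IH; [by rewrite r0|by rewrite r1|].
have := @comp11_diff _ c n.+2 ell ell rho rho' isT l01 l2 r0 r0' r1 r1'
  (fun _ _ => erefl) IH.
rewrite E !subrr mulr0 addr0 => /esym/eqP.
by rewrite !mulf_eq0 (negPf c0) pnatr_eq0 /= subr_eq0 => /eqP.
Qed.

(** The series exchanging the two branches of [ell] at the origin. *)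
Definition deck ell tau :=
  [/\ tau 0%N = 0, tau 1%N = -1 & comp11 ell tau = ell].

(** Both [tau o tau] and [x] have linear part [x], and substituting either of
    them into [ell] gives [ell] back. *)
Lemma deck_involution ell tau : quadratic_start ell ->
  deck ell tau -> comp11 tau tau = X1 R.
Proof.
move=> hl [t0 t1 E]; apply: (comp11_inj hl (oner_neq0 R)) => //.
- by rewrite comp11_0.
- rewrite /comp11 big_ord_recl big_ord1 /= t0 mul0r add0r /bump/= t1.
  by rewrite exp1_lead// t1 mulrNN mulr1.
- by rewrite -comp11A// E E comp11_X1.
Qed.

(** The factor [(-1)^(q+1) - 1] shows that [tau_q] sees the coefficient of
    degree [q + 1] of [ell] only when that degree is odd. *)
Lemma deck_diff q ell ell' tau tau' : (2 <= q)%N ->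
  quadratic_start ell -> quadratic_start ell' ->
  deck ell tau -> deck ell' tau' ->
  (forall m, (m <= q)%N -> ell m = ell' m) ->
  (forall m, (m < q)%N -> tau m = tau' m) ->
  2 * (tau q - tau' q) = ((-1) ^+ q.+1 - 1) * (ell q.+1 - ell' q.+1).
Proof.
move=> q2 [l01 l2] _ [t0 t1 E] [t0' t1' E'] al atau.
have := @comp11_diff _ (-1) q ell ell' tau tau' q2 l01 l2 t0 t0' t1 t1' al atau.
rewrite E E' => H; set e := ell _ - _ in H *; set t := tau _ - _ in H *.
by rewrite mulrBl mul1r {2}H; ring.
Qed.

Lemma deck_agree p ell ell' tau tau' :
  quadratic_start ell -> quadratic_start ell' ->
  deck ell tau -> deck ell' tau' ->
  (forall m, (m <= p)%N -> ell m = ell' m) ->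
  forall m, (m < p)%N -> tau m = tau' m.
Proof.
move=> hl hl' ht ht' al; elim/ltn_ind => -[|[|q]] IH qp.
- by case: ht ht' => -> _ _ [-> _ _].
- by case: ht ht' => _ -> _ [_ -> _].
have := @deck_diff q.+2 _ _ _ _ isT hl hl' ht ht' _ _.
rewrite (al q.+3)// subrr mulr0 => H.
have /eqP : 2 * (tau q.+2 - tau' q.+2) = 0.
  apply: H => m mq; first by apply: al; lia.
  by apply: IH => //; lia.
by rewrite mulf_eq0 pnatr_eq0 /= subr_eq0 => /eqP.
Qed.

Lemma deck_diff_even q ell ell' tau tau' : (2 <= q)%N -> ~~ odd q ->
  quadratic_start ell -> quadratic_start ell' ->
  deck ell tau -> deck ell' tau' ->
  (forall m, (m <= q)%N -> ell m = ell' m) ->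
  tau q - tau' q = - (ell q.+1 - ell' q.+1).
Proof.
move=> q2 eq hl hl' ht ht' al.
have := deck_diff q2 hl hl' ht ht' al
  (deck_agree hl hl' ht ht' al).
by rewrite -signr_odd /= eq expr1; lra.
Qed.

Section Existence.
Variable ell : fps1 R.
Hypothesis hell : quadratic_start ell.

Definition state_deck (f : nat -> R) : fps1 R := fun n =>
  if n is n'.+1 then if n' is 0%N then -1 else f n else 0.

(** As in [newton_step], the defect in degree [n + 1] corrects the coefficient
    of degree [n]; dividing by 2 inverts, up to sign, the factor [2 c] of
    [comp11_diff] at [c = -1]. *)
Definition deck_step (f : nat -> R) n :=
  if (n < 2)%N then 0
  else f n + (comp11 ell (state_deck f) n.+1 - ell n.+1) / 2.

Lemma deck_step_causal n f g : (forall i, (i < n)%N -> f i = g i) ->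
  deck_step f n = deck_step g n.
Proof.
move=> fg; rewrite /deck_step; case: ltnP => // n2; case: (hell) => l01 l2.
have := @comp11_diff _ (-1) n ell ell (state_deck f) (state_deck g) n2 l01 l2
  erefl erefl erefl erefl (fun _ _ => erefl).
have -> : state_deck f n = f n by case: n n2 {fg} => [|[|n]].
have -> : state_deck g n = g n by case: n n2 {fg} => [|[|n]].
rewrite subrr mulr0 addr0 => H.
have {}H : comp11 ell (state_deck f) n.+1 =
   comp11 ell (state_deck g) n.+1 + 2 * -1 * (f n - g n).
  apply/eqP; rewrite addrC -subr_eq; apply/eqP; apply: H => -[|[|m]]//= mn.
  by rewrite fg.
by rewrite H; field.
Qed.

(** Sealed for the same reason as [normal_seal]. *)
Fact deck_seal :
  {t : fps1 R | t = state_deck (causal_fix deck_step (fun=> 0))}.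
Proof. by eexists. Qed.

Definition deck_series := sval deck_seal.

Lemma deck_seriesE : deck_series = state_deck (causal_fix deck_step (fun=> 0)).
Proof. by rewrite /deck_series; case: deck_seal. Qed.

Lemma deck_series_deck : deck ell deck_series.
Proof.
rewrite deck_seriesE; split => //; apply/funext => n; case: (hell) => l01 l2.
case: n => [|[|[|n]]]; rewrite ?comp11_0//.
- by rewrite l01// /comp11 big1// => m _; rewrite l01 ?mul0r.
- rewrite /comp11 big_ord_recr big1 /= => [|m _]; last by rewrite l01 ?mul0r.
  rewrite add0r l2 mul1r.
  by rewrite exp1_lead// sqrrN expr1n.
have := causal_fixE (fun=> 0) deck_step_causal n.+2.
rewrite {1}/deck_step ltnNge /= => /eqP.
rewrite -subr_eq0 addrAC subrr add0r mulf_eq0 invr_eq0 pnatr_eq0 orbF.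
by rewrite subr_eq0 => /eqP.
Qed.
End Existence.
End Involution.

(** * The foliation involution and its dependence on the map *)

Section ComplexPart.
Variable R : realType.
Local Notation C := (Cplx R).

Definition cRe (x : C) : R := complex.Re (x : R[i]).

Lemma cReD x y : cRe (x + y) = cRe x + cRe y.
Proof. by case: x y => [a b] [c d]. Qed.

Lemma cReN x : cRe (- x) = - cRe x.
Proof. by case: x. Qed.

Lemma cReB x y : cRe (x - y) = cRe x - cRe y.
Proof. by rewrite cReD cReN. Qed.

Lemma cRe_conj x : cRe x^* = cRe x.
Proof. by case: x. Qed.

Lemma cRe_real (a : R) : cRe (real_complex R a) = a.
Proof. by []. Qed.

Lemma real_complex_cRe (x : C) : x^* = x -> real_complex R (cRe x) = x.
Proof.
case: x => a b e; have : - b = b by move/(congr1 (@complex.Im R)) : e.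
by move=> e2; have -> : b = 0 by lra.
Qed.

Lemma mul2_conj (A B : fps2 C) j k :
  mul2 (conj_fps A) (conj_fps B) j k = conj_fps (mul2 A B) j k.
Proof.
rewrite /conj_fps /mul2 exchange_big rmorph_sum; apply: eq_bigr => b _.
by rewrite rmorph_sum; apply: eq_bigr => a _; rewrite rmorphM.
Qed.

Lemma exp2_conj (A : fps2 C) m j k :
  exp2 (conj_fps A) m j k = conj_fps (exp2 A m) j k.
Proof.
elim: m j k => [|m IH] j k.
  rewrite /conj_fps !exp2_0 /mono2 andbC.
  by case: ifP; rewrite ?rmorph1 ?rmorph0.
by rewrite !exp2S -mul2_conj; apply: mul2_eq => // *; apply: IH.
Qed.

Lemma conj_fpsK (A : fps2 C) : conj_fps (conj_fps A) = A.
Proof. by apply/funext => j; apply/funext => k; rewrite /conj_fps conjCK. Qed.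

(** Conjugation exchanges the two substituted series. *)
Lemma comp22_conj (F L : fps2 C) j k :
  comp22 (conj_fps L) F (conj_fps F) j k =
  conj_fps (comp22 L F (conj_fps F)) j k.
Proof.
rewrite /conj_fps /comp22 exchange_big addnC rmorph_sum; apply: eq_bigr => s _.
rewrite rmorph_sum; apply: eq_bigr => r _; rewrite rmorphM; congr (_ * _).
rewrite -[RHS]/(conj_fps (mul2 (exp2 F s) (exp2 (conj_fps F) r)) j k).
rewrite -mul2_conj mul2C; apply: mul2_eq => a b _ _; rewrite -exp2_conj//.
by rewrite conj_fpsK.
Qed.

Definition conj1 (Gam : fps1 C) : fps1 C := fun n => (Gam n)^*.

Lemma comp12_conj (Gam : fps1 C) (L : fps2 C) j k :
  comp12 (conj1 Gam) (conj_fps L) j k = conj_fps (comp12 Gam L) j k.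
Proof.
rewrite /conj_fps /comp12 addnC rmorph_sum; apply: eq_bigr => m _.
by rewrite rmorphM exp2_conj.
Qed.

Section Normal.
Variable lam : C.
Hypothesis lam1 : lam * lam^* = 1.
Hypothesis nonres : forall j k, j != k -> lam ^+ j * (lam^* ) ^+ k - 1 != 0.

Definition tangent (F : fps2 C) :=
  [/\ F 0%N 0%N = 0, F 1%N 0%N = lam & F 0%N 1%N = 0].

Lemma tangent_linear_part F : tangent F -> linear_part lam lam^* F (conj_fps F).
Proof.
move=> [F00 F10 F01]; split => -[|[|j]] [|[|k]] // _;
  by rewrite /conj_fps /mono2 /= ?F00 ?F10 ?F01 ?rmorph0.
Qed.

Definition admissible_series (F : fps2 C) := normal_L lam lam^* F (conj_fps F).
Definition admissible_gamma (F : fps2 C) := normal_Gam lam lam^* F (conj_fps F).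

Lemma admissible_normalised F : tangent F ->
  normalised F (conj_fps F) (admissible_series F) (admissible_gamma F).
Proof. by move/tangent_linear_part => h; apply: normal_normalised. Qed.

Lemma admissible_quadratic F : quadratic_part (admissible_series F).
Proof. by rewrite /admissible_series normal_LE; apply: state_L_quadratic. Qed.

(** The conjugates of [L] and [Gam] form another normalised solution for the
    same [F]. *)
Lemma admissible_real F : tangent F ->
  (forall r s, admissible_series F r s = (admissible_series F s r)^* ) /\
  forall m, (admissible_gamma F m)^* = admissible_gamma F m.
Proof.
move=> hF; have hl := tangent_linear_part hF; have n1 := admissible_normalised hF.
have n2 : normalised F (conj_fps F) (conj_fps (admissible_series F))
    (conj1 (admissible_gamma F)).
  case: n1 => hL [hG0 hG1] hd hE; split.
  - move=> j k jk; rewrite /conj_fps hL; last by rewrite addnC.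
    by rewrite /mono2 andbC; case: ifP; rewrite ?rmorph1 ?rmorph0.
  - by rewrite /normal_gamma /conj1 hG0 hG1 rmorph1 rmorph0.
  - by move=> j j1; rewrite /conj_fps hd ?rmorph0.
  - move=> j k; rewrite /conjugacy_defect comp22_conj comp12_conj /conj_fps -rmorphB.
    by have := hE k j; rewrite /conjugacy_defect => ->; rewrite rmorph0.
have H p := normalised_agree (p := p) lam1 nonres hl hl n1 n2
  (fun _ _ _ => erefl) (fun _ _ _ => erefl).
split=> [r s|m].
  by have [H1 _] := H (r + s)%N; rewrite {1}H1.
by have [_ H1] := H (m.*2)%N; rewrite [RHS]H1.
Qed.

Definition real_trace F : fps1 R := fun n => cRe (diagonal (admissible_series F) n).

(** Terms of indices [(r, s)] and [(s, r)] are conjugate to each other. *)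
Lemma diagonal_real F : tangent F ->
  diagonal (admissible_series F) = of_real (real_trace F).
Proof.
move=> hF; apply/funext => n; rewrite /of_real real_complex_cRe//.
rewrite rmorph_sum (reindex_inj rev_ord_inj); apply: eq_bigr => i _ /=.
by rewrite subSS subKn ?leq_ord// -(admissible_real hF).1.
Qed.

Lemma real_trace_quadratic F : quadratic_start (real_trace F).
Proof.
have hL := @admissible_quadratic F.
rewrite /quadratic_start /real_trace /diagonal; split.
  move=> [|[|m]] // _.
    by rewrite big_ord1 hL.
  by rewrite big_ord_recl big_ord1 !hL// addr0.
by rewrite 2!big_ord_recl big_ord1 !hL //= /mono2 /= add0r addr0.
Qed.

Definition involution_of F : fps1 R := deck_series (real_trace F).

Lemma involution_of_deck F : deck (real_trace F) (involution_of F).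
Proof. exact/deck_series_deck/real_trace_quadratic. Qed.

Lemma comp11_of_real (A B : fps1 R) :
  comp11 (of_real A) (of_real B) = of_real (comp11 A B).
Proof.
have H m n : exp1 (of_real B) m n = real_complex R (exp1 B m n).
  elim: m n => [|m IH] n.
    by rewrite /exp1 /=; case: eqP; rewrite ?rmorph1 ?rmorph0.
  rewrite !exp1S /mul1 rmorph_sum; apply: eq_bigr => i _.
  by rewrite rmorphM IH.
apply/funext => n; rewrite /comp11 /of_real rmorph_sum; apply: eq_bigr => m _.
by rewrite rmorphM H.
Qed.

Lemma of_real_X1 : of_real (X1 R) = X1 C.
Proof.
by apply/funext => n; rewrite /of_real /X1; case: eqP; rewrite ?rmorph1 ?rmorph0.
Qed.

Lemma admissible_series_admissible F : tangent F ->
  admissible F (admissible_series F).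
Proof.
move=> hF; have [hL hG _ hE] := admissible_normalised hF.
have [rL rG] := admissible_real hF.
split.
  by split; [exact: rL|rewrite hL|rewrite !hL|rewrite !hL].
exists (fun n => cRe (admissible_gamma F n)).
  by case: hG => h0 h1; split; rewrite /= ?h0 ?h1.
have -> : of_real (fun n => cRe (admissible_gamma F n)) = admissible_gamma F.
  by apply/funext => n; rewrite /of_real real_complex_cRe.
apply/funext => j; apply/funext => k; apply/eqP; rewrite -subr_eq0; apply/eqP.
exact: hE.
Qed.

Lemma involution_of_foliation F : tangent F ->
  foliation_involution F (involution_of F).
Proof.
move=> hF; have [t0 t1 E] := involution_of_deck F; split => //.
  exact: deck_involution (real_trace_quadratic F) (involution_of_deck F).
exists (admissible_series F); first exact: admissible_series_admissible.
have t00 : of_real (involution_of F) 0%N = 0 :> C by rewrite /of_real t0 rmorph0.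
rewrite (comp21_diagonal _ t00) (@comp21_diagonal _ _ (X1 C) erefl).
by rewrite diagonal_real// -of_real_X1 !comp11_of_real E comp11_X1.
Qed.

Lemma conj_fps_agree p (F F' : fps2 C) :
  agree2 p F F' -> agree2 p (conj_fps F) (conj_fps F').
Proof. by move=> H j k jk; rewrite /conj_fps H// addnC. Qed.

Lemma real_trace_agree p F F' : tangent F -> tangent F' -> agree2 p F F' ->
  forall m, (m <= p)%N -> real_trace F m = real_trace F' m.
Proof.
move=> hF hF' aF m mp.
have [aL _] := normalised_agree lam1 nonres (tangent_linear_part hF)
  (tangent_linear_part hF') (admissible_normalised hF)
  (admissible_normalised hF') aF
  (conj_fps_agree aF).
rewrite /real_trace.
suff E : diagonal (admissible_series F) m = diagonal (admissible_series F') m.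
  exact (congr1 (fun x : C => cRe x) E).
by apply: eq_bigr => i _; apply: aL; rewrite subnKC// -ltnS.
Qed.

Lemma involution_of_agree p F F' : tangent F -> tangent F' -> agree2 p F F' ->
  forall m, (m < p)%N -> involution_of F m = involution_of F' m.
Proof.
move=> hF hF' aF; apply: deck_agree (involution_of_deck F)
  (involution_of_deck F') _; try exact: real_trace_quadratic.
exact: real_trace_agree.
Qed.

(** In degree [q + 1], the coefficient of [w^q] in [F] enters the conjugacy
    equation only in the coefficients of [w^(q+1)] and, through the conjugate of
    [F], of [z^(q+1)]. The corresponding coefficients of [L] are conjugate to
    each other, whence the real part, and are divided by [lam^(q+1) - 1] and its
    conjugate. *)
Lemma involution_of_perturbation q F F' : tangent F -> tangent F' ->
  (2 <= q)%N -> ~~ odd q -> agree2 q F F' ->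
  (forall j k, (j + k = q)%N -> (0 < j)%N -> F j k = F' j k) ->
  involution_of F q - involution_of F' q =
  2 * cRe (lam * (F 0%N q - F' 0%N q)^* / (lam ^+ q.+1 - 1)).
Proof.
move=> hF hF' q2 eq aF aFq.
have [aL aGam] := normalised_agree lam1 nonres (tangent_linear_part hF)
  (tangent_linear_part hF') (admissible_normalised hF)
  (admissible_normalised hF') aF
  (conj_fps_agree aF).
have H2 := deck_diff_even q2 eq (real_trace_quadratic F) (real_trace_quadratic F')
  (involution_of_deck F) (involution_of_deck F') (real_trace_agree hF hF' aF).
rewrite H2 /real_trace -cReB /diagonal -sumrB.
have [rL rL'] := ((admissible_real hF).1, (admissible_real hF').1).
have ne j k : (j + k = q.+1)%N -> j != k.
  move=> jk; apply/eqP => ejk; move: (congr1 odd jk) eq.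
  by rewrite ejk addnn odd_double oddS => /esym/negbFE ->.
have E j k : (j + k = q.+1)%N ->
   (lam ^+ j * lam^* ^+ k - 1) *
   (admissible_series F j k - admissible_series F' j k) =
   - (lam^* * shift_w (sub2 F F') j k +
      lam * shift_z (sub2 (conj_fps F) (conj_fps F')) j k).
  move=> jk.
  rewrite (normalised_diff (tangent_linear_part hF)
    (tangent_linear_part hF') (admissible_normalised hF)
    (admissible_normalised hF')).
  - by rewrite (negPf (ne j k jk)) sub0r.
  - by rewrite jk.
  - by rewrite jk; apply: conj_fps_agree.
  - by rewrite jk.
  - by rewrite jk.
have E0 j k : (j + k = q.+1)%N -> (0 < j)%N -> (0 < k)%N ->
    admissible_series F j k - admissible_series F' j k = 0.
  move=> jk j0 k0; have := E _ _ jk.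
  have -> : shift_w (sub2 F F') j k = 0.
    case: k k0 jk => // k _ jk /=; rewrite /sub2 aFq ?subrr//; lia.
  have -> : shift_z (sub2 (conj_fps F) (conj_fps F')) j k = 0.
    case: j j0 jk => // j _ jk /=; rewrite /sub2 /conj_fps aFq ?subrr//; lia.
  rewrite !mulr0 addr0 oppr0 => /eqP; rewrite mulf_eq0 => /orP[|/eqP//].
  by rewrite (negPf (nonres (ne j k jk))).
rewrite big_ord_recl big_ord_recr /= big1 ?add0r; last first.
  by move=> i _; apply: E0; rewrite /bump/=; have := ltn_ord i; lia.
rewrite subn0 /bump /= add1n subnn.
rewrite [admissible_series F 0 _]rL [admissible_series F' 0 _]rL'.
rewrite cReD -rmorphB cRe_conj.
have := E q.+1 0%N (addn0 _); rewrite expr0 mulr1 /= mulr0 add0r.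
have := nonres (j := q.+1) (k := 0) isT; rewrite expr0 mulr1 => n0.
move=> /(canRL (mulKf n0)) ->.
rewrite /sub2 /conj_fps -rmorphB mulrN cReN [_^-1 * _]mulrC.
by rewrite opprD opprK; ring.
Qed.

End Normal.
End ComplexPart.

(** * Modulus and convergence of complex numbers *)

Section Modulus.
Variable R : realType.
Local Notation C := (Cplx R).
Local Notation rc := (real_complex R : R -> C).
Implicit Types x y : C.

Definition cabs x : R := ComplexField.Normc.normc (x : R[i]).

Lemma norm_cabs x : `|x| = rc (cabs x).
Proof. by []. Qed.

Lemma le_rc (a b : R) : (rc a <= rc b) = (a <= b).
Proof. exact: lecR. Qed.

Lemma lt_rc (a b : R) : (rc a < rc b) = (a < b).
Proof. exact: ltcR. Qed.

Lemma rcB (a b : R) : rc (a - b) = rc a - rc b.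
Proof. by rewrite rmorphB. Qed.

Lemma rc_inj : injective rc.
Proof. by move=> a b []. Qed.

Lemma cabs_ge0 x : 0 <= cabs x.
Proof. by rewrite -le_rc -norm_cabs normr_ge0. Qed.

Lemma cabsD x y : cabs (x + y) <= cabs x + cabs y.
Proof. by rewrite -le_rc rmorphD -!norm_cabs ler_normD. Qed.

Lemma cabsB x y : cabs (x - y) <= cabs x + cabs y.
Proof. by rewrite -le_rc rmorphD -!norm_cabs ler_normB. Qed.

Lemma cabsM x y : cabs (x * y) = cabs x * cabs y.
Proof. by apply: rc_inj; rewrite rmorphM -!norm_cabs normrM. Qed.

Lemma cabsX x n : cabs (x ^+ n) = cabs x ^+ n.
Proof. by apply: rc_inj; rewrite rmorphXn -!norm_cabs normrX. Qed.

Lemma cabsV x : cabs (x^-1) = (cabs x)^-1.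
Proof. by apply: rc_inj; rewrite fmorphV -!norm_cabs normfV. Qed.

Lemma cabs0 : cabs 0 = 0.
Proof. by apply: rc_inj; rewrite -norm_cabs normr0. Qed.

Lemma cabs1 : cabs 1 = 1.
Proof. by apply: rc_inj; rewrite -norm_cabs normr1. Qed.

Lemma cabsN x : cabs (- x) = cabs x.
Proof. by apply: rc_inj; rewrite -!norm_cabs normrN. Qed.

Lemma cabs_conj x : cabs (x^*) = cabs x.
Proof. by apply: rc_inj; rewrite -!norm_cabs norm_conjC. Qed.

Lemma cabs_eq0 x : (cabs x == 0) = (x == 0).
Proof. by rewrite -(inj_eq rc_inj) -norm_cabs rmorph0 normr_eq0. Qed.

Lemma cabs_rc (a : R) : cabs (rc a) = `|a|.
Proof. by rewrite /cabs/= expr0n addr0 sqrtr_sqr. Qed.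

Lemma cabs_sum (I : Type) (r : seq I) (P : pred I) (f : I -> C) :
  cabs (\sum_(i <- r | P i) f i) <= \sum_(i <- r | P i) cabs (f i).
Proof.
rewrite -le_rc rmorph_sum -norm_cabs; exact: ler_norm_sum.
Qed.

Lemma cRe_le x : `|cRe x| <= cabs x.
Proof.
case: x => a b; rewrite /cabs/= -sqrtr_sqr ler_wsqrtr// lerDl; exact: sqr_ge0.
Qed.

Definition cIm x : R := complex.Im (x : R[i]).

Lemma cIm_le x : `|cIm x| <= cabs x.
Proof.
case: x => a b; rewrite /cabs/= -sqrtr_sqr ler_wsqrtr// lerDr; exact: sqr_ge0.
Qed.

Lemma cImD x y : cIm (x + y) = cIm x + cIm y.
Proof. by case: x y => [a b] [c d]. Qed.

Definition complex_of (a b : R) : C := Complex a b.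

Lemma complex_ofE x : complex_of (cRe x) (cIm x) = x.
Proof. by case: x. Qed.

Lemma complex_of_rc a b : complex_of a b = rc a + 'i * rc b.
Proof.
rewrite -[('i : C)]/(Complex 0 1 : R[i]).
apply/eqP; rewrite eq_complex /=; apply/andP; split; apply/eqP => /=; ring.
Qed.

Lemma cabs_complex_of a b : cabs (complex_of a b) <= `|a| + `|b|.
Proof.
rewrite complex_of_rc (le_trans (cabsD _ _))// cabsM !cabs_rc.
have -> : cabs 'i = 1 by apply: rc_inj; rewrite -norm_cabs normCi.
by rewrite mul1r.
Qed.

Section Convergence.
Context {T : Type} {F : set_system T} {FF : Filter F}.

Lemma cvgC_lt (f : T -> C) (l : C) :
  f @ F --> l <-> forall e : R, 0 < e -> \forall t \near F, cabs (l - f t) < e.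
Proof.
split => [/cvgrPdist_lt H e e0|H].
  have := H (rc e); rewrite -[0]/(rc 0) lt_rc => /(_ e0).
  by apply: filterS => t; rewrite norm_cabs lt_rc.
apply/cvgrPdist_lt => -[e e'] e0.
have ee : Complex e e' = rc (cRe (Complex e e')).
  by rewrite real_complex_cRe//; apply/CrealP; rewrite realE ltW.
move: e0; rewrite ee -[0]/(rc 0) lt_rc => e0.
have := H _ e0; apply: filterS => t.
by rewrite norm_cabs lt_rc.
Qed.

Lemma cvg_rc (f : T -> R) (l : R) :
  f @ F --> l -> (fun t => rc (f t)) @ F --> rc l.
Proof.
move/cvgrPdist_lt => H; apply/cvgC_lt => e e0; have := H e e0.
apply: filterS => t h; change (cabs (rc l - rc (f t)) < e).
by rewrite -rcB cabs_rc.
Qed.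

Lemma cvg_cRe (f : T -> C) (l : C) :
  f @ F --> l -> (fun t => cRe (f t)) @ F --> cRe l.
Proof.
move/cvgC_lt => H; apply/cvgrPdist_lt => e e0; have := H e e0.
by apply: filterS => t; apply: le_lt_trans; rewrite /= -cReB cRe_le.
Qed.

Lemma cvg_conj (f : T -> C) (l : C) :
  f @ F --> l -> (fun t => (f t)^*) @ F --> l^*.
Proof.
move/cvgC_lt => H; apply/cvgC_lt => e e0; have := H e e0.
by apply: filterS => t; rewrite -rmorphB cabs_conj.
Qed.

Lemma cvg_cabs (f : T -> C) (l : C) :
  f @ F --> l -> (fun t => cabs (f t)) @ F --> cabs l.
Proof.
move/cvgC_lt => H; apply/cvgrPdist_lt => e e0; have := H e e0.
apply: filterS => t; apply: le_lt_trans.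
have E : rc `|cabs l - cabs (f t)| = `| `|l| - `|f t| |.
  by rewrite !norm_cabs -rcB cabs_rc.
by rewrite -le_rc E -norm_cabs; exact: ler_dist_dist.
Qed.

Lemma cvg_complex_of (f g : T -> R) (a b : R) : f @ F --> a -> g @ F --> b ->
  (fun t => complex_of (f t) (g t)) @ F --> complex_of a b.
Proof.
move=> fa gb; rewrite complex_of_rc; under eq_fun do rewrite complex_of_rc.
by apply: cvgD; [exact: cvg_rc|apply: cvgM; [exact: cvg_cst|exact: cvg_rc]].
Qed.

End Convergence.
End Modulus.

(** * Absolutely convergent double series *)

Section BoxSums.
Variable R : realType.
Local Notation C := (Cplx R).
Local Notation rc := (real_complex R : R -> C).

(** Sums over squares, in which [fps_sum] is defined. *)
Definition boxsum (V : nmodType) (a : nat -> nat -> V) n : V :=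
  \sum_(j < n) \sum_(k < n) a j k.

Definition shell (V : nmodType) (a : nat -> nat -> V) n : V :=
  \sum_(k < n) a n k + \sum_(j < n.+1) a j n.

Lemma boxsumS (V : nmodType) (a : nat -> nat -> V) n :
  boxsum a n.+1 = boxsum a n + shell a n.
Proof.
have E j : \sum_(k < n.+1) a j k = \sum_(k < n) a j k + a j n.
  by rewrite big_ord_recr.
rewrite /boxsum /shell big_ord_recr E.
under eq_bigr do rewrite E.
rewrite big_split /= big_ord_recr /= -!addrA; congr (_ + _).
by rewrite addrCA.
Qed.

Definition moduli (a : nat -> nat -> C) : nat -> nat -> R :=
  fun j k => cabs (a j k).

Lemma shell_le (a : nat -> nat -> C) n : cabs (shell a n) <= shell (moduli a) n.
Proof.
rewrite /shell (le_trans (cabsD _ _))// lerD//; exact: cabs_sum.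
Qed.

Lemma boxsum_diff (a : nat -> nat -> C) n i :
  cabs (boxsum a (n + i) - boxsum a n) <=
  boxsum (moduli a) (n + i) - boxsum (moduli a) n.
Proof.
elim: i => [|i IH]; first by rewrite addn0 !subrr cabs0.
rewrite addnS !boxsumS addrAC [X in _ <= X]addrAC.
by rewrite (le_trans (cabsD _ _))// lerD// shell_le.
Qed.

Lemma boxsum_mono (b : nat -> nat -> R) : (forall j k, 0 <= b j k) ->
  {homo boxsum b : n m / (n <= m)%N >-> n <= m}.
Proof.
move=> b0 n m /subnKC <-; elim: (m - n)%N => [|i IH]; first by rewrite addn0.
rewrite addnS boxsumS (le_trans IH)// lerDl addr_ge0// sumr_ge0// => *.
Qed.

Definition box_bounded (a : nat -> nat -> C) :=
  exists B, forall n, boxsum (moduli a) n <= B.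

Section Bounded.
Variable a : nat -> nat -> C.
Hypothesis ba : box_bounded a.

Lemma boxsum_abs_cvg : cvgn (boxsum (moduli a)).
Proof.
apply: nondecreasing_is_cvgn.
  by apply: boxsum_mono => j k; apply: cabs_ge0.
by have [B hB] := ba; exists B => _ [n _ <-].
Qed.

(** A real functional dominated by the modulus gives, after adding the sum of
    the moduli, a nondecreasing bounded sequence; this reduces convergence over
    the complex numbers to completeness of the reals. *)
Lemma boxsum_real_cvg (f : C -> R) :
  (forall x y, f (x + y) = f x + f y) -> (forall x, `|f x| <= cabs x) ->
  cvgn (fun n => f (boxsum a n)).
Proof.
move=> fD fle.
have -> : (fun n => f (boxsum a n)) =
   (fun n => (boxsum (moduli a) n + f (boxsum a n)) - boxsum (moduli a) n).
  by apply/funext => n; rewrite addrAC subrr add0r.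
apply: is_cvgB; last exact: boxsum_abs_cvg.
apply: nondecreasing_is_cvgn.
  apply/nondecreasing_seqP => n.
  rewrite !boxsumS fD addrACA lerDl.
  have := le_trans (fle (shell a n)) (shell_le a n).
  by rewrite ler_norml => /andP[h _]; lra.
have [B hB] := ba; exists (B + B) => _ [n _ <-].
apply: lerD => //; apply: le_trans (ler_norm _) _.
apply: le_trans (fle _) _; apply: le_trans (hB n).
rewrite /boxsum (le_trans (cabs_sum _ _ _))// ler_sum// => j _.
exact: cabs_sum.
Qed.

Lemma boxsum_cvg : cvgn (boxsum a).
Proof.
have h1 := @boxsum_real_cvg (fun x => cRe x) (@cReD R) (@cRe_le R).
have h2 := @boxsum_real_cvg (fun x => cIm x) (@cImD R) (@cIm_le R).
apply/cvg_ex; exists (complex_of (limn (fun n => cRe (boxsum a n)))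
                          (limn (fun n => cIm (boxsum a n)))).
have -> : boxsum a = (fun n => complex_of (cRe (boxsum a n)) (cIm (boxsum a n))).
  by apply/funext => n; rewrite complex_ofE.
apply: cvg_complex_of; [exact: h1|exact: h2].
Qed.

Lemma boxsum_tail n :
  cabs (limn (boxsum a) - boxsum a n) <=
  limn (boxsum (moduli a)) - boxsum (moduli a) n.
Proof.
have h1 : (fun m => cabs (boxsum a m - boxsum a n)) @ \oo -->
    cabs (limn (boxsum a) - boxsum a n).
  by apply: cvg_cabs; apply: cvgB; [exact: boxsum_cvg|exact: cvg_cst].
have h2 : (fun m => boxsum (moduli a) m - boxsum (moduli a) n) @ \oo -->
    limn (boxsum (moduli a)) - boxsum (moduli a) n.
  by apply: cvgB; [exact: boxsum_abs_cvg|exact: cvg_cst].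
apply: (ler_cvg_to h1 h2); exists n => // m /= nm.
by rewrite -(subnKC nm); apply: boxsum_diff.
Qed.

End Bounded.

Definition term (A : fps2 C) (p : C * C) : nat -> nat -> C :=
  fun j k => A j k * p.1 ^+ j * p.2 ^+ k.

Lemma fps_sumE A p : fps_sum A p = limn (boxsum (term A p)).
Proof. by []. Qed.

(** Both directions go through the iterated sum of the moduli, which is the
    extended-real sum over all pairs. *)
Lemma abs_convergentP (A : fps2 C) p :
  abs_convergent_at A p <-> box_bounded (term A p).
Proof.
rewrite /abs_convergent_at /summable.
set x := moduli (term A p).
have x0 j k : 0 <= x j k by apply: cabs_ge0.
have xe0 j k : (0 <= (x j k)%:E)%E by rewrite lee_fin.
have -> : (\esum_(i in [set: nat * nat])
   `|(ComplexField.Normc.normc (A i.1 i.2 * p.1 ^+ i.1 * p.2 ^+ i.2))%:E| =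
   \sum_(0 <= j <oo) \sum_(0 <= k <oo) (x j k)%:E)%E.
  transitivity (\esum_(j in [set: nat]) \esum_(k in [set: nat]) (x j k)%:E)%E.
    rewrite (esum_esum (fun i j _ _ => xe0 i j)).
    have -> : ([set: nat] `*`` (fun=> [set: nat])) = [set: nat * nat].
      by apply/seteqP; split => // -[].
    by apply: eq_esum => -[j k] _ /=; rewrite ger0_norm//; apply: x0.
  rewrite -nneseries_esumT; last by move=> j; apply: esum_ge0.
  by apply: eq_eseriesr => j _; rewrite nneseries_esumT.
have inner0 j : (0 <= \sum_(0 <= k <oo) (x j k)%:E)%E.
  by apply: nneseries_ge0 => *; apply: xe0.
split => [fin|[B hB]].
  set S := (\sum_(0 <= j <oo) _)%E in fin.
  have S0 : (0 <= S)%E by apply: nneseries_ge0 => *; apply: inner0.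
  exists (fine S) => n.
  rewrite -lee_fin fineK ?ge0_fin_numE//.
  rewrite /boxsum -sumEFin.
  apply: (@le_trans _ _ (\sum_(0 <= j < n) \sum_(0 <= k <oo) (x j k)%:E)%E).
    rewrite big_mkord; apply: lee_sum => j _; rewrite -sumEFin.
    rewrite -(big_mkord xpredT (fun k => (x j k)%:E)).
    by apply: nneseries_lim_ge => *; apply: xe0.
  by apply: nneseries_lim_ge => *; apply: inner0.
apply: le_lt_trans (ltry B).
apply: lime_le; first by apply: is_cvg_nneseries => *; apply: inner0.
apply: nearW => m /=; rewrite -nneseries_sum//.
apply: lime_le; first by apply: is_cvg_nneseries => *; apply: sume_ge0.
apply: nearW => n /=.
apply: le_trans (_ : ((boxsum x (maxn m n))%:E <= _)%E); last first.
  by rewrite lee_fin; apply: hB.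
rewrite exchange_big /= !big_mkord /boxsum.
under eq_bigr do rewrite big_mkord sumEFin.
rewrite sumEFin lee_fin.
apply: (@le_trans _ _ (\sum_(i < maxn m n) \sum_(i0 < n) x i i0)).
  rewrite (big_ord_widen _ (fun i => \sum_(i0 < n) x i i0) (leq_maxl m n)).
  rewrite big_mkcond /=; apply: ler_sum => i _; case: ifP => // _.
  exact: sumr_ge0.
apply: ler_sum => i _.
rewrite (big_ord_widen _ (fun i0 => x i i0) (leq_maxr m n)).
by rewrite big_mkcond /=; apply: ler_sum => k _; case: ifP.
Qed.

End BoxSums.

(** * Cauchy's estimate *)

Lemma prim_root_exists (K : numClosedFieldType) n : (0 < n)%N ->
  exists z : K, n.-primitive_root z.
Proof.
move=> n0; have [r rE] := closed_field_poly_normal ('X^n - 1 : {poly K}).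
move: rE; rewrite (monicP _) ?monicXnsubC// scale1r => rE.
have root_r : all n.-unity_root r.
  by apply/allP => z; rewrite -root_prod_XsubC -rE.
have size_r : (n < (size r).+1)%N.
  by rewrite -(size_prod_XsubC r id) -rE size_XnsubC.
have uniq_r : uniq r.
  by rewrite -separable_prod_XsubC -rE separable_Xn_sub_1// pnatr_eq0 -lt0n.
by have /hasP[z _ hz] := has_prim_root n0 root_r uniq_r size_r; exists z.
Qed.

(** The orthogonality relation behind the averaging in [coef_bound1]. *)
Lemma sum_unity_root (K : fieldType) n (w : K) : w ^+ n = 1 -> w != 1 ->
  \sum_(a < n) w ^+ a = 0.
Proof.
move=> wn w1; apply/eqP; have := subrX1 w n; rewrite wn subrr => /esym/eqP.
by rewrite mulf_eq0 subr_eq0 (negPf w1).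
Qed.

Section Cauchy.
Variable R : realType.
Local Notation C := (Cplx R).
Local Notation rc := (real_complex R : R -> C).

(** Averaging the polynomial against a power of a primitive root of unity of
    order [N] on the circle of radius [r] isolates exactly one of its
    coefficients, as there are only [N] of them. *)
Lemma coef_bound1 (c : nat -> C) N (r B : R) j : 0 <= r -> (j < N)%N ->
  (forall z, cabs z = r -> cabs (\sum_(i < N) c i * z ^+ i) <= B) ->
  cabs (c j) * r ^+ j <= B.
Proof.
move=> r0 jN H; have N0 : (0 < N)%N by lia.
have [w hw] := @prim_root_exists C _ N0.
have w1 : cabs w = 1.
  have /eqP : cabs w ^+ N = 1 by rewrite -cabsX (prim_expr_order hw) cabs1.
  by rewrite pexpr_eq1 ?cabs_ge0// => /eqP.
pose S a := \sum_(i < N) c i * (rc r * w ^+ a) ^+ i.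
have SB a : cabs (S a) <= B.
  by apply: H; rewrite cabsM cabs_rc cabsX w1 expr1n mulr1 ger0_norm.
(* The exponent N - j stands for - j, since w^N = 1. *)
have E : \sum_(a < N) w ^+ (a * (N - j)) * S a = N%:R * (c j * rc r ^+ j).
  rewrite /S; under eq_bigr do rewrite mulr_sumr.
  rewrite exchange_big /=.
  have T (i : nat) : (i < N)%N ->
      \sum_(a < N) w ^+ (a * (N - j)) * (c i * (rc r * w ^+ a) ^+ i) =
      c i * rc r ^+ i * (if i == j then N%:R else 0).
    move=> iN.
    transitivity (c i * rc r ^+ i * \sum_(a < N) (w ^+ (N - j + i)) ^+ a).
      rewrite mulr_sumr; apply: eq_bigr => a _.
      rewrite exprMn -!exprM mulnDl exprD [((N - j) * a)%N]mulnC [(i * a)%N]mulnC.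
      by ring.
    congr (_ * _); case: eqP => [->|ij].
      rewrite subnK ?(ltnW jN)// (prim_expr_order hw).
      under eq_bigr do rewrite expr1n.
      by rewrite sumr_const card_ord.
    apply: sum_unity_root.
      by rewrite -exprM mulnC exprM (prim_expr_order hw) expr1n.
    rewrite -(prim_order_dvd hw); apply/dvdnP => -[[|[|q]]] e; first by lia.
      by lia.
    have : (2 * N <= q.+2 * N)%N by rewrite leq_mul2r orbT.
    by lia.
  under eq_bigr do rewrite T//.
  rewrite (bigD1 (Ordinal jN))//= eqxx big1 ?addr0 1?mulrC//.
  move=> i /eqP ij; case: eqP => [e|_]; last by rewrite mulr0.
  by case: ij; apply/val_inj.
have {}E : cabs (N%:R * (c j * rc r ^+ j)) <= \sum_(a < N) B.
  rewrite -E (le_trans (cabs_sum _ _ _))// ler_sum// => a _.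
  by rewrite cabsM cabsX w1 expr1n mul1r.
move: E; rewrite sumr_const card_ord -[B *+ N]mulr_natl !cabsM cabsX cabs_rc.
rewrite ger0_norm//.
have -> : cabs (N%:R : C) = N%:R.
  have -> : (N%:R : C) = rc N%:R by rewrite rmorph_nat.
  by rewrite cabs_rc normr_nat.
by rewrite ler_pM2l// ltr0n.
Qed.

Lemma coef_bound2 (A : fps2 C) N (r B : R) j k : 0 <= r ->
  (j < N)%N -> (k < N)%N ->
  (forall p, cabs p.1 = r -> cabs p.2 = r ->
     cabs (boxsum (term A p) N) <= B) ->
  cabs (A j k) * r ^+ j * r ^+ k <= B.
Proof.
move=> r0 jN kN H.
have -> : cabs (A j k) * r ^+ j * r ^+ k = cabs (A j k * rc r ^+ j) * r ^+ k.
  by rewrite cabsM cabsX cabs_rc ger0_norm.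
apply: (@coef_bound1 (fun k => A j k * rc r ^+ j) N) => // z hz.
have -> : \sum_(i < N) A j i * rc r ^+ j * z ^+ i =
   (\sum_(i < N) A j i * z ^+ i) * rc r ^+ j.
  by rewrite mulr_suml; apply: eq_bigr => i _; rewrite mulrAC.
rewrite cabsM cabsX cabs_rc ger0_norm//.
apply: (@coef_bound1 (fun j => \sum_(i < N) A j i * z ^+ i) N) => // y hy.
have := H (y, z) hy hz; rewrite /boxsum /term /=.
suff -> : \sum_(j0 < N) \sum_(k0 < N) A j0 k0 * y ^+ j0 * z ^+ k0 =
  \sum_(i < N) (\sum_(i0 < N) A i i0 * z ^+ i0) * y ^+ i by [].
by apply: eq_bigr => a _; rewrite mulr_suml; apply: eq_bigr => b _; rewrite mulrAC.
Qed.

Lemma moduli_term (A : fps2 C) p (r s : R) : cabs p.1 = r -> cabs p.2 = s ->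
  moduli (term A p) = fun j k => cabs (A j k) * r ^+ j * s ^+ k.
Proof.
move=> h1 h2; apply/funext => j; apply/funext => k.
by rewrite /moduli /term !cabsM !cabsX h1 h2.
Qed.

(** The estimate holds for the partial sums over squares; their distance to the
    sum of the series is bounded on the whole torus by the tail of the series of
    moduli, which tends to 0. *)
Lemma cauchy_estimate (A : fps2 C) (r B : R) j k : 0 <= r ->
  box_bounded (term A (rc r, rc r)) ->
  (forall p, cabs p.1 = r -> cabs p.2 = r -> cabs (fps_sum A p) <= B) ->
  cabs (A j k) * r ^+ j * r ^+ k <= B.
Proof.
move=> r0 bA H.
have cr : cabs (rc r) = r by rewrite cabs_rc ger0_norm.
have E p : cabs p.1 = r -> cabs p.2 = r ->
    moduli (term A p) = moduli (term A (rc r, rc r)).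
  by move=> h1 h2; rewrite (moduli_term _ h1 h2) (@moduli_term _ (rc r, rc r) r r).
set T := boxsum (moduli (term A (rc r, rc r))).
have cT : cvgn T by apply: boxsum_abs_cvg.
have hN N : (maxn j k < N)%N ->
    cabs (A j k) * r ^+ j * r ^+ k <= B + (limn T - T N).
  rewrite gtn_max => /andP[jN kN]; apply: (@coef_bound2 A N) => // p h1 h2.
  have bp : box_bounded (term A p).
    by have [b hb] := bA; exists b => n; rewrite E.
  have := boxsum_tail bp N; rewrite E// -/T => ht.
  rewrite -[boxsum _ _](subKr (limn (boxsum (term A p)))).
  apply: le_trans (cabsB _ _) _; apply: lerD => //.
  exact: H.
have h2 : (fun n => B + (limn T - T n)) @ \oo --> B + (limn T - limn T).
  by apply: cvgD; [exact: cvg_cst|apply: cvgB => //; exact: cvg_cst].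
rewrite subrr addr0 in h2.
apply: (ler_cvg_to (cvg_cst _) h2); exists (maxn j k).+1 => // n /= hn.
Qed.

End Cauchy.

(** * Continuity of the coefficients for the compact-open topology *)

Lemma compact_subtype (X : topologicalType) (A K : set X) :
  compact K -> K `<=` A -> compact ((@set_val X A) @^-1` K).
Proof.
move=> cK KA F FF FK.
have [x [Kx clx]] := cK (set_val @ F) _ FK.
exists (exist _ x (mem_set (KA _ Kx))); split; first by rewrite /= set_valE.
move=> P Q FP [_ [[W oW <-] /= Wx WQ]]; rewrite set_valE /= in Wx.
have FP' : F (set_val @^-1` (set_val @` P)).
  by apply: (filterS _ FP) => z Pz; exists z.
have [y [[z Pz <-] Wz]] := clx _ W FP' (open_nbhs_nbhs (conj oW Wx)).
by exists z; split => //; apply: WQ.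
Qed.

Section Coefficients.
Variable R : realType.
Local Notation C := (Cplx R).
Local Notation rc := (real_complex R : R -> C).

Lemma entourage_cabs (e : R) : 0 < e ->
  entourage [set xy : C * C | cabs (xy.1 - xy.2) < e].
Proof.
move=> e0; rewrite -entourage_ballE.
exists (rc e); first by rewrite /= -[0]/(rc 0) lt_rc.
by move=> [x y] /=; rewrite /ball /= norm_cabs lt_rc.
Qed.

Lemma bidiscP (Delta : R) (p : C * C) :
  bidisc Delta p <-> cabs p.1 < Delta /\ cabs p.2 < Delta.
Proof. by rewrite /bidisc /= !norm_cabs !lt_rc. Qed.

(** A compact set that contains the disc of radius [r]; its compactness follows
    from that of real segments. *)
Definition square (r : R) : set C :=
  (fun ab : R * R => complex_of ab.1 ab.2) @` (`[- r, r] `*` `[- r, r]).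

Lemma square_compact r : compact (square r).
Proof.
apply: continuous_compact; last first.
  by apply: compact_setX; exact: segment_compact.
apply: continuous_subspaceT => ab.
by apply: cvg_complex_of; [exact: cvg_fst|exact: cvg_snd].
Qed.

Lemma square_cabs r x : cabs x = r -> square r x.
Proof.
move=> xr; exists (cRe x, cIm x); last exact: complex_ofE.
by split; rewrite /= in_itv /= -ler_norml -xr; [exact: cRe_le|exact: cIm_le].
Qed.

Lemma cabs_square r x : square r x -> cabs x <= r + r.
Proof.
move=> [[a b] [/= ha hb] <-]; apply: le_trans (cabs_complex_of _ _) _.
by move: ha hb; rewrite /= !in_itv /= -!ler_norml; exact: lerD.
Qed.

Lemma boxsum_sub (a b : nat -> nat -> C) n :
  boxsum (fun j k => a j k - b j k) n = boxsum a n - boxsum b n.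
Proof.
by rewrite /boxsum -sumrB; apply: eq_bigr => j _; rewrite sumrB.
Qed.

Lemma term_sub (A B : fps2 C) p :
  term (sub2 A B) p = fun j k => term A p j k - term B p j k.
Proof.
by apply/funext => j; apply/funext => k; rewrite /term /sub2; ring.
Qed.

Lemma box_bounded_sub (a b : nat -> nat -> C) : box_bounded a ->
  box_bounded b -> box_bounded (fun j k => a j k - b j k).
Proof.
move=> [A hA] [B hB]; exists (A + B) => n.
apply: le_trans (lerD (hA n) (hB n)).
rewrite /boxsum -big_split; apply: ler_sum => j _ /=.
by rewrite -big_split; apply: ler_sum => k _ /=; apply: cabsB.
Qed.

Lemma fps_sum_sub (A B : fps2 C) p :
  box_bounded (term A p) -> box_bounded (term B p) ->
  fps_sum (sub2 A B) p = fps_sum A p - fps_sum B p.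
Proof.
move=> bA bB; rewrite !fps_sumE term_sub; apply: cvg_lim => //.
have -> : boxsum (fun j k => term A p j k - term B p j k) =
  (fun n => boxsum (term A p) n - boxsum (term B p) n).
  by apply/funext => n; apply: boxsum_sub.
by apply: cvgB; apply: boxsum_cvg.
Qed.

Section Space.
Variables omega Delta : R.
Hypothesis hDelta : 0 < Delta.
Local Notation T := (analytic_diffeo_space omega Delta).

Lemma analytic_bounded (F : T) p : bidisc Delta p ->
  box_bounded (term (series_of F) p).
Proof.
case: F => F hF; have [_ hol] := set_mem hF => hp.
by apply/abs_convergentP; have [] := hol p hp.
Qed.

Lemma extension_continuous (F : T) :
  continuous (@restricted_extension _ omega Delta F : bidisc Delta -> (C * C)%type).
Proof.
move=> p; rewrite /restricted_extension.
apply: (@continuous_comp _ _ _ (@set_val _ (bidisc Delta)) (complex_extension (val F))).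
  exact: initial_continuous.
apply: differentiable_continuous; case: F => F hF.
have [_ hol] := set_mem hF; have [_ _ ] := hol (set_val p) (set_mem (valP p)).
by [].
Qed.

(** On continuous functions the compact-open topology is that of uniform
    convergence on compact sets. The first component is the one that determines
    the coefficients. *)
Lemma near_uniform (F : T) (K : set (bidisc Delta)) (e : R) :
  compact K -> 0 < e ->
  \forall G \near F, forall p, K p ->
    cabs ((complex_extension (series_of F) (val p)).1 -
          (complex_extension (series_of G) (val p)).1) < e.
Proof.
move=> cK e0.
pose f (G : T) : bidisc Delta -> C :=
  fun p => (complex_extension (series_of G) (val p)).1.
have cf : continuous (f F).
  move=> p; apply: (@continuous_comp _ _ _
    (@restricted_extension _ omega Delta F : bidisc Delta -> (C * C)%type) fst).
    exact: extension_continuous.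
  exact: cvg_fst.
have c : @restricted_extension _ omega Delta @ F --> restricted_extension F.
  exact: initial_continuous.
have NF : Filter (nbhs F) by exact: nbhs_filter.
have fc : {compact-open, f @ F --> f F}.
  apply/(@compact_open_cvgP _ _ _ _ (fmap_filter f NF)) => K' O cK' oO fO.
  move/(@compact_open_cvgP _ _ _ _ (fmap_filter _ NF)) : c => /(_ K' (fst @^-1` O) cK').
  have oO' : open (fst @^-1` O : set (C * C)).
    by apply: open_comp => // x _; exact: cvg_fst.
  move=> /(_ oO'); rewrite /= => H.
  have : [set restricted_extension F x | x in K'] `<=` fst @^-1` O.
    by move=> _ [x Kx <-]; apply: fO; exists x.
  move/H; apply: filterS => G hG _ [x Kx <-].
  by apply: (hG (restricted_extension G x)); exists x.
move/(compact_open_fam_compactP cf (fmap_filter f NF)) : fc.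
move/(@fam_cvgP _ _ _ _ _ (fmap_filter f NF)) => /(_ K cK).
move=> /(_ [set h | forall p, K p -> cabs (f F p - h p) < e]); apply.
apply/uniform_nbhs; exists [set xy : C * C | cabs (xy.1 - xy.2) < e].
by split; [exact: entourage_cabs|].
Qed.

(** Cauchy's estimate applied to the difference of two maps, on a torus inside a
    compact part of the bidisc. *)
Lemma coef_continuous j k : continuous (fun F : T => series_of F j k : C).
Proof.
move=> F; have NF : Filter (nbhs F) by exact: nbhs_filter.
apply/(@cvgC_lt R _ _ NF) => e e0.
(* The square of half-side r lies in the disc of radius 2 r < Delta. *)
pose r := Delta / 3.
have r0 : 0 < r by apply: divr_gt0.
have rD : r + r < Delta.
  by have h := hDelta; rewrite /r -mulrDl ltr_pdivrMr ?ltr0n//; lra.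
pose K := (@set_val _ (bidisc Delta)) @^-1` (square r `*` square r).
have cK : compact K.
  apply: compact_subtype; first by apply: compact_setX; exact: square_compact.
  move=> p [h1 h2]; apply/bidiscP.
  by split; apply: le_lt_trans rD; apply: cabs_square.
have e1 : 0 < e * (r ^+ j * r ^+ k) / 2 by rewrite !mulr_gt0// ?exprn_gt0// invr_gt0.
have := near_uniform F cK e1; apply: filterS => G hG.
have bd p : cabs p.1 = r -> cabs p.2 = r -> bidisc Delta p.
  by move=> h1 h2; apply/bidiscP; rewrite h1 h2; split; lra.
have cr : cabs (rc r) = r by rewrite cabs_rc gtr0_norm.
have := @cauchy_estimate R (sub2 (series_of F) (series_of G)) r
  (e * (r ^+ j * r ^+ k) / 2) j k (ltW r0).
rewrite term_sub => H.
have {}H : cabs (sub2 (series_of F) (series_of G) j k) * r ^+ j * r ^+ k <=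
   e * (r ^+ j * r ^+ k) / 2.
  apply: H.
    by apply: box_bounded_sub; apply: analytic_bounded; apply: bd.
  move=> p h1 h2; have hp := bd _ h1 h2.
  rewrite fps_sum_sub; [|exact: analytic_bounded..].
  have := hG (exist _ p (mem_set hp)); rewrite /complex_extension /=.
  move=> H; apply/ltW/H; split; exact: square_cabs.
have P0 : 0 < r ^+ j * r ^+ k by rewrite mulr_gt0// exprn_gt0.
rewrite -(ltr_pM2r P0) mulrA; apply: le_lt_trans H _.
have := mulr_gt0 e0 P0; set x := e * _; lra.
Qed.

End Space.
End Coefficients.

(** * Continuity of the involution in the coefficients of the map *)

Section CoefficientwiseConvergence.
Variables (K : numFieldType) (T : Type) (F : set_system T).
Context {FF : Filter F}.

(** Convergence of each coefficient: the coefficients of all the constructions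
    above are polynomial in those of the data, up to division by fixed divisors
    and conjugation. *)
Definition cvg2 (A : T -> fps2 K) (A0 : fps2 K) :=
  forall j k, (fun t => A t j k) @ F --> A0 j k.
Definition cvg1 (A : T -> fps1 K) (A0 : fps1 K) :=
  forall n, (fun t => A t n) @ F --> A0 n.

Lemma cvg_bigsum (I : Type) (r : seq I) (P : pred I)
    (f : T -> I -> K) (g : I -> K) :
  (forall i, (fun t => f t i) @ F --> g i) ->
  (fun t => \sum_(i <- r | P i) f t i) @ F --> \sum_(i <- r | P i) g i.
Proof.
move=> fg; elim: r => [|i r IH].
  rewrite big_nil; under eq_fun do rewrite big_nil; exact: cvg_cst.
rewrite big_cons; under eq_fun do rewrite big_cons.
by case: (P i) => //; apply: cvgD.
Qed.

Lemma cvg2_cst A : cvg2 (fun=> A) A.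
Proof. by move=> j k; apply: cvg_cst. Qed.

Lemma cvg2_mul A A0 B B0 : cvg2 A A0 -> cvg2 B B0 ->
  cvg2 (fun t => mul2 (A t) (B t)) (mul2 A0 B0).
Proof.
move=> hA hB j k; do 2!(apply: cvg_bigsum => ?).
by apply: cvgM; [apply: hA|apply: hB].
Qed.

Lemma cvg2_exp A A0 m : cvg2 A A0 ->
  cvg2 (fun t => exp2 (A t) m) (exp2 A0 m).
Proof.
move=> hA; elim: m => [|m IH]; first exact: cvg2_cst.
exact: cvg2_mul.
Qed.

Lemma cvg2_comp22 L L0 A A0 B B0 : cvg2 L L0 -> cvg2 A A0 -> cvg2 B B0 ->
  cvg2 (fun t => comp22 (L t) (A t) (B t)) (comp22 L0 A0 B0).
Proof.
move=> hL hA hB j k; do 2!(apply: cvg_bigsum => ?).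
apply: cvgM; first exact: hL.
by apply: cvg2_mul; apply: cvg2_exp.
Qed.

Lemma cvg2_comp12 G G0 A A0 : cvg1 G G0 -> cvg2 A A0 ->
  cvg2 (fun t => comp12 (G t) (A t)) (comp12 G0 A0).
Proof.
move=> hG hA j k; apply: cvg_bigsum => m.
by apply: cvgM; [exact: hG|exact: cvg2_exp].
Qed.

Lemma cvg1_mul A A0 B B0 : cvg1 A A0 -> cvg1 B B0 ->
  cvg1 (fun t => mul1 (A t) (B t)) (mul1 A0 B0).
Proof.
move=> hA hB n; apply: cvg_bigsum => ?.
by apply: cvgM; [apply: hA|apply: hB].
Qed.

Lemma cvg1_exp A A0 m : cvg1 A A0 ->
  cvg1 (fun t => exp1 (A t) m) (exp1 A0 m).
Proof.
move=> hA; elim: m => [|m IH]; first by move=> n; apply: cvg_cst.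
exact: cvg1_mul.
Qed.

Lemma cvg1_comp11 A A0 B B0 : cvg1 A A0 -> cvg1 B B0 ->
  cvg1 (fun t => comp11 (A t) (B t)) (comp11 A0 B0).
Proof.
move=> hA hB n; apply: cvg_bigsum => m.
by apply: cvgM; [exact: hA|exact: cvg1_exp].
Qed.

Variables lam mu : K.

Definition cvg_state (f : T -> state K) (f0 : state K) :=
  (forall d j, (fun t => (f t d).1 j) @ F --> (f0 d).1 j) /\
  (forall d, (fun t => (f t d).2) @ F --> (f0 d).2).

Lemma cvg_state_L f f0 : cvg_state f f0 ->
  cvg2 (fun t => state_L (f t)) (state_L f0).
Proof.
move=> [hf _] j k; rewrite /state_L; case: ifP => _; first exact: cvg_cst.
by case: ifP => _; [exact: cvg_cst|exact: hf].
Qed.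

Lemma cvg_state_Gam f f0 : cvg_state f f0 ->
  cvg1 (fun t => state_Gam (f t)) (state_Gam f0).
Proof.
move=> [_ hf] m; rewrite /state_Gam; case: ifP => _; first exact: cvg_cst.
exact: hf.
Qed.

Lemma cvg_conjugacy_defect A A0 B B0 L L0 G G0 :
  cvg2 A A0 -> cvg2 B B0 -> cvg2 L L0 -> cvg1 G G0 ->
  cvg2 (fun t => conjugacy_defect (A t) (B t) (L t) (G t))
    (conjugacy_defect A0 B0 L0 G0).
Proof.
move=> hA hB hL hG j k; apply: cvgB; first exact: cvg2_comp22.
exact: cvg2_comp12.
Qed.

Lemma cvg_newton_step A A0 B B0 f f0 :
  cvg2 A A0 -> cvg2 B B0 -> cvg_state f f0 ->
  cvg_state (fun t => newton_step lam mu (A t) (B t) (f t))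
            (newton_step lam mu A0 B0 f0).
Proof.
move=> hA hB hf.
have hE := cvg_conjugacy_defect hA hB (cvg_state_L hf) (cvg_state_Gam hf).
case: hf => hf1 hf2; split => [d j|d]; rewrite /newton_step /=.
  case: ifP => _; last exact: cvg_cst.
  by apply: cvgB => //; apply: cvgM; [exact: hE|exact: cvg_cst].
by case: ifP => _; [apply: cvgD => //; exact: hE|exact: cvg_cst].
Qed.

(** Each coefficient is a coefficient of a fixed finite iterate of the
    correction step. *)
Lemma cvg_normal_L A A0 B B0 : cvg2 A A0 -> cvg2 B B0 ->
  cvg2 (fun t => normal_L lam mu (A t) (B t)) (normal_L lam mu A0 B0).
Proof.
move=> hA hB; rewrite normal_LE; under eq_fun do rewrite normal_LE.
apply: cvg_state_L; rewrite /normal_state /causal_fix.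
have H m : cvg_state
    (fun t => iter m (newton_step lam mu (A t) (B t)) (@zero_state K))
    (iter m (newton_step lam mu A0 B0) (@zero_state K)).
  elim: m => [|m IH]; first by split => *; apply: cvg_cst.
  exact: cvg_newton_step.
by split => [d j|d]; have [h1 h2] := H d.+1; [exact: h1|exact: h2].
Qed.

End CoefficientwiseConvergence.

Lemma cvg_deck_series (R : realType) (T : Type) (F : set_system T)
    (FF : Filter F) (ell : T -> fps1 R) ell0 :
  cvg1 F ell ell0 ->
  cvg1 F (fun t => deck_series (ell t)) (deck_series ell0).
Proof.
move=> hl; rewrite deck_seriesE; under eq_fun do rewrite deck_seriesE.
have st (f : T -> fps1 R) f0 : cvg1 F f f0 ->
    cvg1 F (fun t => state_deck (f t)) (state_deck f0).
  by move=> hf [|[|n]]; [exact: cvg_cst|exact: cvg_cst|exact: hf].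
have step (f : T -> fps1 R) f0 : cvg1 F f f0 ->
    cvg1 F (fun t => deck_step (ell t) (f t)) (deck_step ell0 f0).
  move=> hf d; rewrite /deck_step; case: ifP => _; first exact: cvg_cst.
  apply: cvgD; first exact: hf.
  apply: cvgM; last exact: cvg_cst.
  apply: cvgB; last exact: hl.
  exact: (cvg1_comp11 hl (st _ _ hf)).
apply: (st) => n; rewrite /causal_fix.
have H m : cvg1 F (fun t => iter m (deck_step (ell t)) (fun=> 0))
    (iter m (deck_step ell0) (fun=> 0)).
  elim: m => [|m IH]; first by move=> d; apply: cvg_cst.
  exact: step.
exact: H.
Qed.

Lemma cvg_involution_of (R : realType) (lam : Cplx R) (T : Type) (F : set_system T)
    (FF : Filter F) (A : T -> fps2 (Cplx R)) A0 : cvg2 F A A0 ->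
  cvg1 F (fun t => involution_of lam (A t)) (involution_of lam A0).
Proof.
move=> hA; apply: cvg_deck_series => n.
apply: cvg_cRe; apply: cvg_bigsum => r.
have hB : cvg2 F (fun t => conj_fps (A t)) (conj_fps A0).
  by move=> j k; apply: cvg_conj; apply: hA.
exact (@cvg_normal_L _ _ _ _ lam lam^* _ _ _ _ hA hB r (n - r)%N).
Qed.

(** * Power series with rapidly decreasing coefficients *)

(** Differentiability is local. The sums of the perturbed series are only known
    on the bidisc, which is why this is needed. *)
Lemma near_eq_differentiable (K : numFieldType) (V W : normedModType K)
    (f g : V -> W) (x : V) :
  {near x, f =1 g} -> differentiable f x -> differentiable g x.
Proof.
move=> fg df; have [cd fe] := (diff_locallyP x f).1 df.
have gx : g x = f x by rewrite (nbhs_singleton fg).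
have ge : g \o shift x = cst (g x) + 'd f x +o_ (0 : V) id.
  apply/eqaddoP => _/posnumP[e].
  have /eqaddoP/(_ e%:num (gt0 e)) := fe.
  have : \forall h \near (0 : V), f (h + x) = g (h + x).
    have c : (fun h : V => h + x) @ (0 : V) --> x.
      rewrite -[X in _ --> X]add0r.
      by apply: cvgD; [exact: cvg_id|exact: cvg_cst].
    exact: (c _ fg).
  apply: filterS2 => h fgh.
  by rewrite gx -[(g \o _ - _) h]/(g (h + x) - (f x + 'd f x h)) -fgh.
have E := diff_unique cd ge.
apply/diff_locallyP; split; last by rewrite E.
by rewrite E.
Qed.

Lemma expr_diff_step (K : comNzRingType) (w v : K) k :
  w ^+ k.+1 - v ^+ k.+1 - (v ^+ k.+1.-1 *+ k.+1) * (w - v) =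
  w * (w ^+ k - v ^+ k - (v ^+ k.-1 *+ k) * (w - v)) +
  (v ^+ k.-1 *+ k) * (w - v) ^+ 2.
Proof.
have H : v ^+ k *+ k = v * (v ^+ k.-1 *+ k).
  by case: k => [|k]; rewrite ?mulr0n ?mulr0//= exprS mulrnAr.
rewrite /= mulrSr H !exprS; move: (v ^+ k.-1 *+ k) (v ^+ k) (w ^+ k).
by move=> P V W; ring.
Qed.

Lemma growth_rate_error (K : fieldType) (h x d : K) : h != 0 ->
  d - h^-1 * x = - (h^-1 * (x - d * h)).
Proof. by move=> h0; field. Qed.

Section PowerSeries.
Variable R : realType.
Local Notation C := (Cplx R).
Local Notation rc := (real_complex R : R -> C).

Lemma boxsum_emb (V : comNzRingType) (a : nat -> V) n :
  boxsum (emb_w a) n = \sum_(k < n) a k.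
Proof.
rewrite /boxsum; case: n => [|n]; first by rewrite !big_ord0.
rewrite big_ord_recl /= [X in _ + X]big1 ?addr0// => j _.
by rewrite big1.
Qed.

Lemma geometric_sum_le (e : R) n : 0 <= e ->
  \sum_(k < n) e / 2 ^+ k <= e + e.
Proof.
move=> e0; suff -> : \sum_(k < n) e / 2 ^+ k = (e + e) * (1 - (2 ^+ n)^-1).
  rewrite ler_piMr ?addr_ge0// gerBl invr_ge0 exprn_ge0//.
elim: n => [|n IH]; first by rewrite big_ord0 expr0 invr1 subrr mulr0.
rewrite big_ord_recr /= IH exprS; field.
by rewrite expf_neq0.
Qed.

Section Geometric.
Variables (a : nat -> C) (e : R).
Hypothesis ae : forall k, cabs (a k) <= e / 2 ^+ k.

Lemma geometric_e0 : 0 <= e.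
Proof. by have := le_trans (cabs_ge0 _) (ae 0); rewrite expr0 divr1. Qed.

Lemma geometric_sum_bound n : cabs (\sum_(k < n) a k) <= e + e.
Proof.
rewrite (le_trans (cabs_sum _ _ _))//.
apply: le_trans (geometric_sum_le n geometric_e0).
by apply: ler_sum => k _.
Qed.

Lemma geometric_bounded : box_bounded (emb_w a).
Proof.
exists (e + e) => n.
have -> : moduli (emb_w a) = emb_w (fun k => cabs (a k)).
  apply/funext => j; apply/funext => k; rewrite /moduli /emb_w.
  by case: ifP; rewrite ?cabs0.
rewrite boxsum_emb; apply: le_trans (geometric_sum_le n geometric_e0).
by apply: ler_sum => k _.
Qed.

Lemma geometric_cvg : cvgn (fun n => \sum_(k < n) a k).
Proof.
have := boxsum_cvg geometric_bounded.
by have -> : boxsum (emb_w a) = (fun n => \sum_(k < n) a k)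
  by apply/funext => n; rewrite boxsum_emb.
Qed.

Lemma geometric_lim : cabs (limn (fun n => \sum_(k < n) a k)) <= e + e.
Proof.
have h : (fun n => cabs (\sum_(k < n) a k)) @ \oo -->
    cabs (limn (fun n => \sum_(k < n) a k)).
  exact: cvg_cabs geometric_cvg.
have h2 : (fun _ : nat => e + e) @ \oo --> e + e by exact: cvg_cst.
apply: (ler_cvg_to h h2); apply: nearW => n.
exact: geometric_sum_bound.
Qed.

End Geometric.

Lemma deriv_monomial_bound (rho : R) (v : C) m : 1 <= rho -> cabs v <= rho ->
  cabs (v ^+ m.-1 *+ m) <= (4 * rho) ^+ m.
Proof.
move=> r1 vr; have r0 : 0 <= rho by lra.
rewrite -mulr_natl cabsM cabsX.
have -> : cabs (m%:R : C) = m%:R.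
  have -> : (m%:R : C) = rc m%:R by rewrite rmorph_nat.
  by rewrite cabs_rc normr_nat.
rewrite exprMn ler_pM ?ler0n ?exprn_ge0 ?cabs_ge0//.
  by rewrite -natrX ler_nat ltnW// ltn_expl.
apply: (@le_trans _ _ (rho ^+ m.-1)).
  by rewrite lerXn2r ?nnegrE ?cabs_ge0.
by rewrite ler_weXn2l// leq_pred.
Qed.

(** The second-order Taylor remainder of a power, with a crude geometric
    constant: the coefficients it will be multiplied with decrease fast enough.
    *)
Lemma expr_diff_bound (rho : R) (w v : C) k : 1 <= rho ->
  cabs w <= rho -> cabs v <= rho ->
  cabs (w ^+ k - v ^+ k - (v ^+ k.-1 *+ k) * (w - v)) <=
  (4 * rho) ^+ k * cabs (w - v) ^+ 2.
Proof.
move=> r1 wr vr; have r0 : 0 <= rho by lra.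
elim: k => [|k IH].
  by rewrite !expr0 subrr sub0r mulr0n mul0r oppr0 cabs0 mul1r exprn_ge0 ?cabs_ge0.
rewrite expr_diff_step.
apply: le_trans (cabsD _ _) _.
rewrite (cabsM w) (cabsM (_ *+ k)) (cabsX (w - v)) [(4 * rho) ^+ _]exprS -mulrA.
set d := cabs (w - v) ^+ 2 in IH *; set q := (4 * rho) ^+ k in IH *.
have d0 : 0 <= d by rewrite exprn_ge0 ?cabs_ge0.
have q0 : 0 <= q by rewrite exprn_ge0// mulr_ge0.
have qd := mulr_ge0 q0 d0.
have h1 : cabs w * cabs (w ^+ k - v ^+ k - v ^+ k.-1 *+ k * (w - v)) <= rho * (q * d).
  by apply: ler_pM; rewrite ?cabs_ge0.
have h2 : cabs (v ^+ k.-1 *+ k) * d <= 1 * (q * d).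
  by rewrite mul1r ler_wpM2r// deriv_monomial_bound.
apply: le_trans (lerD h1 h2) _.
by rewrite -mulrDl ler_wpM2r//; lra.
Qed.

Definition power_sum (c : nat -> C) (w : C) : C :=
  limn (fun n => \sum_(k < n) c k * w ^+ k).

Section SmallCoefficients.
Variables (Delta e : R) (c : nat -> C).
Hypothesis hDelta : 0 < Delta.
(* The margin 1 leaves room for small increments and makes rho at least 1; the
   rate 8 rho below is twice the constant 4 rho of [expr_diff_bound], so that
   the products decrease like 2^-k. *)
Let rho := Delta + 1.
Hypothesis small : forall k, cabs (c k) <= e * (8 * rho)^-1 ^+ k.

Let rho1 : 1 <= rho. Proof. by rewrite /rho lerDr ltW. Qed.
Let e0 : 0 <= e.
Proof. by have := le_trans (cabs_ge0 _) (small 0); rewrite expr0 mulr1. Qed.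

Let scale k : (8 * rho)^-1 ^+ k * (4 * rho) ^+ k = (2 ^+ k)^-1.
Proof.
rewrite -exprMn -exprVn; congr (_ ^+ k); field.
by rewrite gt_eqF//; have := rho1; lra.
Qed.

Lemma small_mul k (x : C) (y : R) : 0 <= y -> cabs x <= (4 * rho) ^+ k * y ->
  cabs (c k * x) <= (e * y) / 2 ^+ k.
Proof.
move=> y0 hx; rewrite cabsM.
have h := ler_pM (cabs_ge0 _) (cabs_ge0 _) (small k) hx.
apply: le_trans h _; rewrite -scale le_eqVlt; apply/orP; left; apply/eqP; ring.
Qed.

Lemma small_term k w : cabs w <= rho -> cabs (c k * w ^+ k) <= e / 2 ^+ k.
Proof.
move=> wr; rewrite -[e in X in _ <= X]mulr1; apply: small_mul => //.
rewrite cabsX mulr1; apply: lerXn2r; rewrite ?nnegrE ?cabs_ge0//.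
  by rewrite mulr_ge0//; have := rho1; lra.
by have := rho1; lra.
Qed.

Lemma power_sum_bound w : cabs w <= rho -> cabs (power_sum c w) <= e + e.
Proof.
move=> wr; apply: (@geometric_lim (fun k => c k * w ^+ k) e) => k.
exact: small_term.
Qed.

Lemma power_sum_cvg w : cabs w <= rho ->
  (fun n => \sum_(k < n) c k * w ^+ k) @ \oo --> power_sum c w.
Proof.
move=> wr; apply: (@geometric_cvg (fun k => c k * w ^+ k) e) => k.
exact: small_term.
Qed.

Definition power_sum_deriv (v : C) : C :=
  limn (fun n => \sum_(k < n) c k * (v ^+ k.-1 *+ k)).

(** The sum over [k] of the Taylor remainders of [c_k w^k], in which the
    constant [4 rho] of [expr_diff_bound] is beaten by the decrease of [c_k]. *)
Lemma power_sum_expansion v w : cabs v <= rho -> cabs w <= rho ->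
  cabs (power_sum c w - power_sum c v - power_sum_deriv v * (w - v)) <=
  (e + e) * cabs (w - v) ^+ 2.
Proof.
move=> vr wr.
have hd : (fun n => \sum_(k < n) c k * (v ^+ k.-1 *+ k)) @ \oo --> power_sum_deriv v.
  apply: (@geometric_cvg (fun k => c k * (v ^+ k.-1 *+ k)) e) => k.
  rewrite -[e in X in _ <= X]mulr1.
  by apply: small_mul => //; rewrite mulr1; apply: deriv_monomial_bound.
pose a k := c k * (w ^+ k - v ^+ k - (v ^+ k.-1 *+ k) * (w - v)).
have ha k : cabs (a k) <= (e * cabs (w - v) ^+ 2) / 2 ^+ k.
  apply: small_mul; first by rewrite exprn_ge0 ?cabs_ge0.
  exact: expr_diff_bound.
have L : (fun n => \sum_(k < n) c k * w ^+ k - \sum_(k < n) c k * v ^+ k -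
    (\sum_(k < n) c k * (v ^+ k.-1 *+ k)) * (w - v)) @ \oo -->
    power_sum c w - power_sum c v - power_sum_deriv v * (w - v).
  apply: cvgB; first by apply: cvgB; apply: power_sum_cvg.
  by apply: cvgM; [exact: hd|exact: cvg_cst].
set B := _ * _ ^+ 2.
have h2 : (fun _ : nat => B) @ \oo --> B by exact: cvg_cst.
apply: (ler_cvg_to (cvg_cabs L) h2); apply: nearW => n.
rewrite /B mulrDl; apply: le_trans (geometric_sum_bound ha n).
rewrite le_eqVlt; apply/orP; left; apply/eqP; congr (cabs _).
by rewrite mulr_suml -!sumrB; apply: eq_bigr => k _; rewrite /a; ring.
Qed.

Lemma power_sum_differentiable v : cabs v < Delta ->
  differentiable (power_sum c : C -> C) (v : C).
Proof.
move=> vD; apply/derivable1_diffP; apply/cvg_ex; exists (power_sum_deriv v).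
apply/cvgC_lt => d d0.
have dd : 0 < d / (e + e + 1) by rewrite divr_gt0//; have := e0; lra.
have : \forall h \near (0 : C), cabs h < d / (e + e + 1) /\ cabs h < 1.
  have h0 : (fun h : C => cabs h) @ (0 : C) --> cabs (0 : C).
    exact: (@cvg_cabs R C (nbhs (0 : C)) (nbhs_filter (0 : C)) id 0 (fun A h => h)).
  rewrite cabs0 in h0.
  by apply: filterI; apply: (cvgr_lt _ h0).
rewrite /dnbhs /within /=; apply: filterS => h [h1 h2] h0.
have hn : 0 < cabs h by rewrite lt0r cabs_eq0 h0 cabs_ge0.
have vr : cabs v <= rho by rewrite /rho; lra.
have wr : cabs (h + v) <= rho.
  by apply: le_trans (cabsD _ _) _; rewrite /rho; lra.
have := power_sum_expansion vr wr; rewrite addrK => H.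
have -> : power_sum_deriv v - h^-1 *: (power_sum c (h *: 1 + v) - power_sum c v) =
   - (h^-1 * (power_sum c (h + v) - power_sum c v - power_sum_deriv v * h)).
  have -> : h *: (1 : C) = h by rewrite /GRing.scale /= mulr1.
  exact: growth_rate_error.
rewrite cabsN cabsM cabsV mulrC ltr_pdivrMr//.
apply: le_lt_trans H _.
rewrite expr2 mulrA ltr_pM2r//.
have h3 : cabs h * (e + e + 1) < d by rewrite -ltr_pdivlMr//; have := e0; lra.
apply: le_lt_trans h3.
by have := cabs_ge0 h; rewrite mulrC; nra.
Qed.

End SmallCoefficients.
End PowerSeries.

(** * Perturbing an analytic map by a series in the conjugate variable *)

Section Perturbation.
Variable R : realType.
Local Notation C := (Cplx R).
Local Notation rc := (real_complex R : R -> C).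
Variables (omega Delta : R).
Hypothesis hDelta : 0 < Delta.
Local Notation T := (analytic_diffeo_space omega Delta).

Lemma near_bidisc p : bidisc Delta p -> \forall q \near p, bidisc Delta q.
Proof.
move=> /bidiscP[h1 h2].
have c1 : (fun q : C * C => cabs q.1) @ p --> cabs p.1.
  by apply: (@cvg_cabs R _ (nbhs p) (nbhs_filter p) fst); exact: cvg_fst.
have c2 : (fun q : C * C => cabs q.2) @ p --> cabs p.2.
  by apply: (@cvg_cabs R _ (nbhs p) (nbhs_filter p) snd); exact: cvg_snd.
have n1 : \forall q \near p, cabs q.1 < Delta by apply: (cvgr_lt _ c1).
have n2 : \forall q \near p, cabs q.2 < Delta by apply: (cvgr_lt _ c2).
near=> q; apply/bidiscP; split; near: q; [exact: n1|exact: n2].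
Unshelve. all: by end_near. Qed.

Variables (e : R) (c : nat -> C).
Hypothesis small : forall k, cabs (c k) <= e * (8 * (Delta + 1))^-1 ^+ k.

Definition cconj (k : nat) : C := (c k)^*.

Lemma cconj_small k : cabs (cconj k) <= e * (8 * (Delta + 1))^-1 ^+ k.
Proof. by rewrite /cconj cabs_conj. Qed.

Lemma bidisc_rho p : bidisc Delta p ->
  cabs p.1 <= Delta + 1 /\ cabs p.2 <= Delta + 1.
Proof. by move=> /bidiscP[h1 h2]; split; lra. Qed.

Lemma term_emb p : term (emb_w c) p = emb_w (fun k => c k * p.2 ^+ k).
Proof.
apply/funext => j; apply/funext => k; rewrite /term /emb_w.
by case: eqP => [->|_]; rewrite ?expr0 ?mulr1 ?mul0r.
Qed.

Lemma term_conj_emb p :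
  term (conj_fps (emb_w c)) p = fun j k => emb_w (fun j => cconj j * p.1 ^+ j) k j.
Proof.
apply/funext => j; apply/funext => k; rewrite /term /conj_fps /emb_w.
by case: eqP => [->|_]; rewrite ?expr0 ?mulr1 ?rmorph0 ?mul0r.
Qed.

Lemma boxsum_flip (V : nmodType) (a : nat -> nat -> V) n :
  boxsum (fun j k => a k j) n = boxsum a n.
Proof. by rewrite /boxsum exchange_big. Qed.

Lemma emb_bounded p : bidisc Delta p -> box_bounded (term (emb_w c) p).
Proof.
move=> /bidisc_rho[_ h2]; rewrite term_emb.
apply: (@geometric_bounded _ _ e) => k.
exact: (small_term hDelta small).
Qed.

Lemma conj_emb_bounded p : bidisc Delta p ->
  box_bounded (term (conj_fps (emb_w c)) p).
Proof.
move=> /bidisc_rho[h1 _]; rewrite term_conj_emb.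
have [B hB] : box_bounded (emb_w (fun j => cconj j * p.1 ^+ j)).
  apply: (@geometric_bounded _ _ e) => k.
  exact: (small_term hDelta cconj_small).
by exists B => n; rewrite (le_trans _ (hB n))// -boxsum_flip.
Qed.

Lemma fps_sum_emb p : fps_sum (emb_w c) p = power_sum c p.2.
Proof.
rewrite fps_sumE term_emb.
by have -> : boxsum (emb_w (fun k => c k * p.2 ^+ k)) =
  (fun n => \sum_(k < n) c k * p.2 ^+ k)
  by apply/funext => n; rewrite boxsum_emb.
Qed.

Lemma fps_sum_conj_emb p : fps_sum (conj_fps (emb_w c)) p = power_sum cconj p.1.
Proof.
rewrite fps_sumE term_conj_emb.
by have -> : boxsum (fun j k => emb_w (fun j => cconj j * p.1 ^+ j) k j) =
  (fun n => \sum_(k < n) cconj k * p.1 ^+ k)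
  by apply/funext => n; rewrite boxsum_flip boxsum_emb.
Qed.

Lemma conj_fps_sub (A B : fps2 C) :
  conj_fps (sub2 A B) = sub2 (conj_fps A) (conj_fps B).
Proof.
by apply/funext => j; apply/funext => k; rewrite /conj_fps /sub2 rmorphB.
Qed.

Lemma analytic_conj_bounded (F : T) p : bidisc Delta p ->
  box_bounded (term (conj_fps (series_of F)) p).
Proof.
case: F => F hF; have [_ hol] := set_mem hF => hp.
by apply/abs_convergentP; have [] := hol p hp.
Qed.

Definition perturbed (F : fps2 C) : fps2 C := sub2 F (emb_w c).

Lemma perturbed_extension (F : T) p : bidisc Delta p ->
  complex_extension (perturbed (series_of F)) p =
  complex_extension (series_of F) p - (power_sum c p.2, power_sum cconj p.1).
Proof.
move=> hp; rewrite /complex_extension /perturbed conj_fps_sub.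
rewrite fps_sum_sub; [|exact: analytic_bounded|exact: emb_bounded].
rewrite fps_sum_sub; [|exact: analytic_conj_bounded|exact: conj_emb_bounded].
by rewrite fps_sum_emb fps_sum_conj_emb.
Qed.

Lemma analytic_differentiable (F : T) (p : C * C) : bidisc Delta p ->
  differentiable (complex_extension (series_of F)) p.
Proof.
by case: F => F hF; have [_ hol] := set_mem hF => hp; have [] := hol p hp.
Qed.

(** On the bidisc, the extension differs from that of [F] by a map of the form
    [(g(w), g~(z))] with [g] and [g~] holomorphic there. *)
Lemma perturbed_analytic (F : T) : c 0%N = 0 -> c 1%N = 0 ->
  analytic_diffeo omega Delta (perturbed (series_of F)).
Proof.
move=> c0 c1; split.
  case: (F) => G hG /=; have [[g00 g10 g01] _] := set_mem hG.
  by rewrite /perturbed /sub2 /emb_w /series_of /=; split; rewrite ?c0 ?c1 ?subr0.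
move=> p hp; split.
- apply/abs_convergentP; rewrite /perturbed term_sub.
  by apply: box_bounded_sub; [exact: analytic_bounded|exact: emb_bounded].
- apply/abs_convergentP; rewrite /perturbed conj_fps_sub term_sub.
  apply: box_bounded_sub; [exact: analytic_conj_bounded|].
  exact: conj_emb_bounded.
apply: (@near_eq_differentiable _ _ _ (fun p => complex_extension (series_of F) p -
   (power_sum c p.2, power_sum cconj p.1))).
  have := near_bidisc hp; apply: filterS => q hq.
  by rewrite perturbed_extension.
have /bidiscP[h1 h2] := hp.
apply: differentiableB; first exact: analytic_differentiable.
apply: differentiable_pair.
  apply: (@differentiable_comp _ _ _ _ snd (power_sum c)).
    apply: linear_differentiable => q; exact: cvg_snd.
  exact: (power_sum_differentiable hDelta small).
apply: (@differentiable_comp _ _ _ _ fst (power_sum cconj)).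
  apply: linear_differentiable => q; exact: cvg_fst.
exact: (power_sum_differentiable hDelta cconj_small).
Qed.

Lemma perturbed_close (F : T) p : bidisc Delta p ->
  cabs ((complex_extension (series_of F) p).1 -
    (complex_extension (perturbed (series_of F)) p).1) <= e + e /\
  cabs ((complex_extension (series_of F) p).2 -
    (complex_extension (perturbed (series_of F)) p).2) <= e + e.
Proof.
move=> hp; have [h1 h2] := bidisc_rho hp.
rewrite perturbed_extension//.
case: (complex_extension (series_of F) p) => x y /=.
rewrite !subKr; split.
  exact: (power_sum_bound hDelta small).
exact: (power_sum_bound hDelta cconj_small).
Qed.

End Perturbation.

(** * Successive binary choices and growth of coefficients *)

Section BinaryChoice.
Variable P : nat -> (nat -> bool) -> Prop.

Definition update (b : nat -> bool) q v : nat -> bool :=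
  fun i => if i == q then v else b i.

Hypothesis local : forall q b b',
  (forall i, (i <= q)%N -> b i = b' i) -> P q b -> P q b'.
Hypothesis alternative : forall q b, P q (update b q true) \/ P q (update b q false).

Fixpoint choices n : nat -> bool :=
  if n is q.+1 then
    update (choices q) q `[< P q (update (choices q) q true) >]
  else fun=> false.

(** The value at [q] is chosen so that [P q] holds for the values chosen so far;
    later choices do not affect it. *)
Lemma binary_choice : exists b, forall q, P q b.
Proof.
pose b q := choices q.+1 q; exists b => q.
have agree m i : (i < m)%N -> choices m i = b i.
  elim: m => // m IH; rewrite ltnS leq_eqVlt => /orP[/eqP -> //|im].
  by rewrite /= /update ltn_eqF// IH.
apply: (local (b := choices q.+1)) => [i iq|]; first exact: agree.
rewrite /=; case: asboolP => // nP.
by have [] := alternative q (choices q).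
Qed.

End BinaryChoice.

Lemma infinite_nat_ge (S : set nat) N : infinite_set S ->
  exists2 k, S k & (N <= k)%N.
Proof.
move=> infS; apply: contrapT => H; apply: infS.
apply: (sub_finite_set _ (finite_II N)) => k Sk /=.
by rewrite ltnNge; apply/negP => Nk; apply: H; exists k.
Qed.

Lemma leq_fact k : (k <= k`!)%N.
Proof. by case: k => // k; rewrite factS leq_pmulr// fact_gt0. Qed.

Section Divergence.
Variable R : realType.

(** The terms of a convergent power series are bounded, so that its coefficients
    are dominated by a geometric sequence. *)
Lemma superexponential_divergent (a : fps1 R) :
  (forall M : nat, exists n, M%:R ^+ n.+1 < `|a n|) -> divergent a.
Proof.
move=> H; apply/eqP; rewrite eq_le; apply/andP; split; last first.
  apply: ereal_sup_ubound; exists 0; last by rewrite normr0.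
  rewrite /=; apply: (is_cvg_near_cst (a 0%N)).
  exists 1%N => // -[|n] //= _.
  rewrite /pseries /series /= big_mkord big_ord_recl expr0 mulr1 big1 ?addr0//.
  by move=> i _; rewrite /= expr0n mulr0.
apply: ub_ereal_sup => _ [x /= cx <-]; rewrite lee_fin.
have [->|x0] := eqVneq x 0; first by rewrite normr0.
exfalso; have := cvg_series_cvg_0 cx.
move/cvgrPdist_lt => /(_ 1 ltr01)[N _ hN].
have nx : 0 < `|x| by rewrite normr_gt0.
(* The finite sum takes care of the terms before the terms of the series become
   smaller than 1, the inverse of x of those after. *)
pose b := \sum_(n < N) `|a n| + `|x|^-1 + 1.
have s0 : 0 <= \sum_(n < N) `|a n| by apply: sumr_ge0.
have ix : 0 < `|x|^-1 by rewrite invr_gt0.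
have b0 : 0 <= b by rewrite /b; lra.
have := archi_boundP b0; set M := Num.bound b => bM.
have [n] := H M; apply/negP; rewrite -leNgt.
have M1 : 1 <= M%:R :> R by move: bM; rewrite /b; lra.
have [nN|Nn] := ltnP n N.
  apply: (@le_trans _ _ M%:R); last by rewrite -[X in X <= _]expr1 ler_weXn2l.
  apply: (@le_trans _ _ b); last exact: ltW.
  have : `|a n| <= \sum_(n < N) `|a n|.
    by rewrite (bigD1 (Ordinal nN))//= lerDl sumr_ge0.
  by rewrite /b; lra.
have := hN n Nn; rewrite /= sub0r normrN normrM normrX => h.
apply: (@le_trans _ _ (`|x|^-1 ^+ n)).
  by rewrite exprVn -[_^-1]mul1r ler_pdivlMr ?exprn_gt0// ltW.
apply: (@le_trans _ _ (M%:R ^+ n)); last by rewrite ler_weXn2l.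
rewrite lerXn2r ?nnegrE ?ler0n// ?ltW//.
by apply: le_lt_trans bM; rewrite /b; lra.
Qed.

(** The terms of the exponential series at [M / t] tend to 0. *)
Lemma fact_beats_geometric (e t : R) (M : nat) : 0 < e -> 0 < t ->
  exists N, forall k, (N <= k)%N -> M%:R ^+ k < e * t ^+ k * k`!%:R.
Proof.
move=> e0 t0; have /cvgrPdist_lt/(_ e e0)[N _ hN] := cvg_exp_coeff (M%:R / t).
exists N => k Nk; have := hN k Nk; rewrite /= sub0r normrN /exp_coeff.
have f0 : 0 < k`!%:R :> R by rewrite ltr0n fact_gt0.
have tk : 0 < t ^+ k by rewrite exprn_gt0.
rewrite ger0_norm; last by rewrite divr_ge0 ?exprn_ge0 ?divr_ge0 ?ler0n ?ltW.
by rewrite ltr_pdivrMr// expr_div_n ltr_pdivrMr// mulrAC.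
Qed.

End Divergence.

(** * The multiplier and its small divisors *)

Section SmallDivisors.
Variable R : realType.
Local Notation C := (Cplx R).
Local Notation rc := (real_complex R : R -> C).
Variable omega : R.
Hypothesis hk : infinite_set [set k : nat |
  odd k /\ (k`!)%:R <= `|multiplier omega ^+ k - 1|^-1].
Local Notation lam := (multiplier omega).

Lemma multiplier_conj : lam * lam^* = 1.
Proof.
rewrite -[lam^*]/(Complex (cos (2 * pi * omega)) (- sin (2 * pi * omega)) : C).
apply/eqP; rewrite eq_complex /=; apply/andP; split; apply/eqP; last by ring.
by rewrite mulrN opprK -!expr2 cos2Dsin2.
Qed.

Lemma cabs_multiplier : cabs lam = 1.
Proof.
have : cabs lam ^+ 2 = 1.
  by rewrite expr2 -{2}(cabs_conj lam) -cabsM multiplier_conj cabs1.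
by move/eqP; rewrite pexpr_eq1 ?cabs_ge0// => /eqP.
Qed.

(** The inequality forces the divisor to be nonzero, because the inverse of 0 is
    0. *)
Lemma small_divisors N : exists k, [/\ (N <= k)%N, odd k,
  0 < cabs (lam ^+ k - 1) & k`!%:R <= (cabs (lam ^+ k - 1))^-1].
Proof.
have [k [ok hkk] Nk] := infinite_nat_ge N hk; exists k.
have h : k`!%:R <= (cabs (lam ^+ k - 1))^-1.
  rewrite -le_rc; have -> : rc k`!%:R = k`!%:R by rewrite rmorph_nat.
  have -> : rc (cabs (lam ^+ k - 1))^-1 = `|lam ^+ k - 1|^-1.
    by rewrite norm_cabs fmorphV.
  exact: hkk.
split => //; rewrite lt0r cabs_ge0 andbT; apply/eqP => z.
by move: h; rewrite z invr0 lern0 -leqn0 leqNgt fact_gt0.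
Qed.

(** If [lam] were a root of unity, the powers of [lam] would take finitely many
    values, and the inverses of the nonzero divisors could not exceed every
    factorial. *)
Lemma multiplier_not_root n : (0 < n)%N -> lam ^+ n != 1.
Proof.
move=> n0; apply/eqP => ln.
pose b := \sum_(j < n) (cabs (lam ^+ j - 1))^-1.
have b0 : 0 <= b by apply: sumr_ge0 => j _; rewrite invr_ge0 cabs_ge0.
have := archi_boundP b0; set M := Num.bound b => bM.
have [k [Mk _ _]] := small_divisors M.
apply/negP; rewrite -ltNge; apply: (@le_lt_trans _ _ b); last first.
  apply: lt_le_trans bM _; rewrite ler_nat; apply: leq_trans Mk _.
  exact: leq_fact.
have -> : lam ^+ k = lam ^+ (k %% n).
  by rewrite {1}(divn_eq k n) exprD mulnC exprM ln expr1n mul1r.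
have kn : (k %% n < n)%N by rewrite ltn_pmod.
rewrite /b (bigD1 (Ordinal kn))//= lerDl; apply: sumr_ge0 => j _.
by rewrite invr_ge0 cabs_ge0.
Qed.

Lemma multiplier_nonresonant j k : j != k -> lam ^+ j * lam^* ^+ k - 1 != 0.
Proof.
have H i m : (0 < i)%N -> lam ^+ (m + i) * lam^* ^+ m != 1.
  move=> i0; rewrite addnC exprD -mulrA -exprMn multiplier_conj expr1n mulr1.
  exact: multiplier_not_root.
rewrite subr_eq0; case: (ltngtP j k) => // jk _; last first.
  by rewrite -{1}(subnKC (ltnW jk)) H// subn_gt0.
apply/eqP => /(congr1 Num.conj); rewrite rmorphM !rmorphXn /= conjCK rmorph1 mulrC.
by apply/eqP; rewrite -{1}(subnKC (ltnW jk)) H// subn_gt0.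
Qed.

End SmallDivisors.

(** * Genericity *)

Section UniformCloseness.
Variable R : realType.
Local Notation C := (Cplx R).
Local Notation rc := (real_complex R : R -> C).
Variable U : topologicalType.

Definition uniformly_close (f g : U -> (C * C)%type) (e : R) :=
  forall p, cabs ((f p).1 - (g p).1) <= e /\ cabs ((f p).2 - (g p).2) <= e.

(** The sets of functions uniformly close to [f] generate a filter that
    converges to [f] uniformly, hence for the compact-open topology. *)
Lemma compact_open_uniform (f : U -> (C * C)%type)
    (O : set {compact-open, U -> (C * C)%type}) :
  continuous f -> open O -> O f ->
  exists2 e : R, 0 < e & forall g, uniformly_close f g e -> O g.
Proof.
move=> cf oO Of.
pose Phi := filter_from [set e : R | 0 < e] (fun e => uniformly_close f ^~ e).
have FPhi : Filter Phi.
  apply: filter_from_filter; first by exists 1; rewrite /= ltr01.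
  move=> a b a0 b0; exists (Num.min a b); first by rewrite /= lt_min a0.
  by move=> g hg; split=> p; have [h1 h2] := hg p;
    move: h1 h2; rewrite !le_min => /andP[? ?] /andP[? ?].
have fam : {family compact, Phi --> f}.
  apply/fam_cvgP => K cK W /uniform_nbhs[E [entE EW]].
  apply: (@filterS _ Phi FPhi _ _ EW).
  move: entE; rewrite -entourage_ballE => -[r /= r0 hr].
  have rE : r = rc (cRe r).
    by rewrite real_complex_cRe//; apply/CrealP; rewrite realE ltW.
  have r0' : 0 < cRe r by move: r0; rewrite rE -[0]/(rc 0) lt_rc.
  exists (cRe r / 2); first by rewrite /= divr_gt0.
  move=> g hg p _; apply: hr; have [h1 h2] := hg p.
  rewrite rE; split; rewrite /ball /= norm_cabs lt_rc.
    by apply: le_lt_trans h1 _; lra.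
  by apply: le_lt_trans h2 _; lra.
have co : {compact-open, Phi --> f}.
  apply/compact_open_cvgP => K O' cK oO' fKO.
  have := fam _ (fam_compact_nbhs oO' fKO cK cf); apply: filterS.
  by move=> g hg _ [p Kp <-]; apply: hg.
have [e e0 he] := co O (open_nbhs_nbhs (conj oO Of)).
by exists e.
Qed.

End UniformCloseness.

Lemma far_apart (R : realDomainType) (x y B E : R) :
  x - y = 2 * E -> B <= E -> `|x| < B -> B <= `|y|.
Proof.
move=> xy BE xB; have := ler_normB x y; rewrite xy.
by have := ler_norm (2 * E); lra.
Qed.

Section Generic.
Variable R : realType.
Local Notation C := (Cplx R).
Local Notation rc := (real_complex R : R -> C).
Variables omega Delta : R.
Hypothesis hk : infinite_set [set k : nat |
  odd k /\ (k`!)%:R <= `|multiplier omega ^+ k - 1|^-1].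
Hypothesis hDelta : 0 < Delta.
Local Notation lam := (multiplier omega).
Local Notation T := (analytic_diffeo_space omega Delta).
Local Notation tauF F := (involution_of (multiplier omega) F).

Let lam1 := @multiplier_conj R omega.
Let nonres := multiplier_nonresonant hk.

Lemma series_of_tangent (F : T) : tangent lam (series_of F).
Proof. by case: F => F hF; have [] := set_mem hF. Qed.

Definition large_coefficient (M : nat) : set T :=
  [set F | exists n, M%:R ^+ n.+1 < `|tauF (series_of F) n|].

Lemma large_coefficient_open M : open (large_coefficient M).
Proof.
rewrite openE => F [n hn].
have NF : Filter (nbhs F) by exact: nbhs_filter.
have c : (fun G : T => tauF (series_of G) n) @ F --> tauF (series_of F) n.
  apply: cvg_involution_of => j k; exact: coef_continuous.
have c2 : (fun G : T => `|tauF (series_of G) n|) @ F --> `|tauF (series_of F) n|.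
  exact: (cvg_norm c).
have := @cvgr_gt _ _ _ NF _ _ c2 _ hn.
by apply: filterS => G hG; exists n.
Qed.

Lemma large_coefficients_divergent (F : T) :
  (forall M, large_coefficient M F) -> has_divergent_involution (series_of F).
Proof.
move=> H; exists (tauF (series_of F)).
  by apply: involution_of_foliation => //; exact: series_of_tangent.
exact: superexponential_divergent.
Qed.

Section Density.
Variables (F : T) (e : R).
Hypothesis e0 : 0 < e.

Let t := (8 * (Delta + 1))^-1.
Let t0 : 0 < t.
Proof. by rewrite invr_gt0 mulr_gt0// addr_gt0. Qed.
Let t1 : t <= 1.
Proof. by rewrite invf_le1; have := hDelta; [lra|rewrite mulr_gt0// addr_gt0]. Qed.

Definition small_divisor_at q := [&& (2 <= q)%N, ~~ odd q, lam ^+ q.+1 != 1 &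
  q.+1`!%:R <= (cabs (lam ^+ q.+1 - 1))^-1].

(** The phase is such that [lam * (- kick q)^* / (lam^(q+1) - 1)] is the
    positive real number [e t^q / |lam^(q+1) - 1|], which maximises the real
    part in [involution_of_perturbation]. *)
Definition kick q : C :=
  - (lam^* * rc (e * t ^+ q / cabs (lam ^+ q.+1 - 1)) * (lam ^+ q.+1 - 1))^*.

Definition kicks (b : nat -> bool) q : C :=
  if small_divisor_at q && b q then kick q else 0.

Lemma small_divisor_pos q : small_divisor_at q -> 0 < cabs (lam ^+ q.+1 - 1).
Proof.
by move=> /and4P[_ _ h _]; rewrite lt0r cabs_ge0 cabs_eq0 subr_eq0 h.
Qed.

Lemma kick_cabs q : small_divisor_at q -> cabs (kick q) = e * t ^+ q.
Proof.
move=> gq; have h := small_divisor_pos gq.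
rewrite /kick cabsN cabs_conj !cabsM cabs_conj cabs_multiplier mul1r cabs_rc.
rewrite ger0_norm ?divfK ?gt_eqF//.
by rewrite divr_ge0 ?mulr_ge0 ?exprn_ge0// ltW.
Qed.

Lemma kicks_small b q : cabs (kicks b q) <= e * t ^+ q.
Proof.
rewrite /kicks; case: ifP => [/andP[gq _]|_]; first by rewrite kick_cabs.
by rewrite cabs0 mulr_ge0 ?exprn_ge0// ltW.
Qed.

Definition kicked b : fps2 C := perturbed (kicks b) (series_of F).

Lemma kicked_analytic b : analytic_diffeo omega Delta (kicked b).
Proof. by apply: (perturbed_analytic hDelta (kicks_small b)). Qed.

Lemma kicked_tangent b : tangent lam (kicked b).
Proof. by have [] := kicked_analytic b. Qed.

Lemma kicked_agree q b b' : (forall i, (i < q)%N -> b i = b' i) ->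
  agree2 q (kicked b) (kicked b').
Proof.
move=> bb j k jk; rewrite /kicked /perturbed /sub2 /emb_w; case: ifP => // _.
by rewrite /kicks bb//; lia.
Qed.

Definition large_at q b :=
  small_divisor_at q -> e * t ^+ q * q.+1`!%:R <= `|tauF (kicked b) q|.

(** The coefficient of degree [q] of the involution depends on the coefficients
    of the map up to degree [q]. *)
Lemma large_at_local q b b' : (forall i, (i <= q)%N -> b i = b' i) ->
  large_at q b -> large_at q b'.
Proof.
move=> bb H gq; apply: le_trans (H gq) _.
have E : tauF (kicked b) q = tauF (kicked b') q.
  apply: (@involution_of_agree R lam lam1 nonres q.+1) => //;
    [exact: kicked_tangent|exact: kicked_tangent|exact: kicked_agree].
by move: E; move: (tauF _ _) (tauF _ _) => x y ->.
Qed.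

Lemma kick_effect q b : small_divisor_at q ->
  tauF (kicked (update b q true)) q - tauF (kicked (update b q false)) q =
  2 * (e * t ^+ q / cabs (lam ^+ q.+1 - 1)).
Proof.
move=> gq; have h := small_divisor_pos gq.
have /and4P[q2 eq l1 _] := gq.
have A := @involution_of_perturbation R lam lam1 nonres q _ _
  (kicked_tangent (update b q true)) (kicked_tangent (update b q false)) q2 eq.
rewrite A.
- have -> : kicked (update b q true) 0 q - kicked (update b q false) 0 q = - kick q.
    rewrite /kicked /perturbed /sub2 /emb_w /kicks gq /update eqxx /=.
    by rewrite subr0 addrAC subrr add0r.
  rewrite /kick opprK conjCK !mulrA lam1 mul1r mulfK ?subr_eq0 //.
  by rewrite cRe_real !mulrA.
- by apply: kicked_agree => i iq; rewrite /update ltn_eqF.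
- move=> j k jk j0; rewrite /kicked /perturbed /sub2 /emb_w.
  by rewrite gtn_eqF.
Qed.

(** The two candidates for [tau_q] are too far apart for both to be small. *)
Lemma large_at_alternative q b :
  large_at q (update b q true) \/ large_at q (update b q false).
Proof.
have [gq|ngq] := boolP (small_divisor_at q); last by left => gq; rewrite gq in ngq.
have h := small_divisor_pos gq; have D := kick_effect b gq.
have /and4P[_ _ _ hf] := gq.
set x := tauF _ _ in D; set y := tauF _ _ in D.
set B := e * t ^+ q * q.+1`!%:R.
have Bh : B <= e * t ^+ q / cabs (lam ^+ q.+1 - 1).
  by rewrite /B ler_wpM2l// mulr_ge0 ?exprn_ge0// ltW.
have [hx|hx] := lerP B `|x|; first by left.
right => _; exact: (far_apart D Bh hx).
Qed.

Lemma divergent_nearby : exists2 G : T, (forall M, large_coefficient M G) &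
  uniformly_close (restricted_extension F : bidisc Delta -> (C * C)%type)
                  (restricted_extension G) (e + e).
Proof.
have [b hb] := binary_choice large_at_local large_at_alternative.
exists (exist _ (kicked b) (mem_set (kicked_analytic b))); last first.
  move=> p; apply: (perturbed_close hDelta (kicks_small b)).
  exact: set_mem (valP p).
move=> M; have [N hN] := fact_beats_geometric M e0 t0.
(* With k >= 3 the perturbation of degree k - 1 spares the linear part. *)
have [k [Nk ok k0 hf]] := small_divisors hk (maxn N 3).
move: Nk; rewrite geq_max => /andP[Nk k3].
case: k k3 ok k0 hf Nk => // q q2 oq k0 hf Nk.
exists q; apply: lt_le_trans (hN _ Nk) _.
have gq : small_divisor_at q.
  by apply/and4P; split => //; rewrite -subr_eq0 -cabs_eq0 gt_eqF.
apply: le_trans (hb q gq).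
rewrite ler_wpM2r ?ler0n// (ler_wpM2l (ltW e0))//.
exact: (ler_wiXn2l (ltW t0) t1 (leqnSn q)).
Qed.

End Density.

(** An open set for the initial topology is the preimage of a compact-open
    neighbourhood, which contains every function uniformly close to the given
    one. *)
Lemma large_coefficients_dense : dense (\bigcap_M large_coefficient M).
Proof.
move=> O [F OF] [V oV VO].
have VF : V (restricted_extension F) by rewrite -VO in OF.
have [e e0 he] := compact_open_uniform (@extension_continuous R omega Delta F) oV VF.
have e2 : 0 < e / 2 by rewrite divr_gt0.
have [G hG hclose] := divergent_nearby F e2.
exists G; split; last by move=> M _; exact: hG.
rewrite -VO; apply: he; move: hclose; by rewrite -splitr.
Qed.

End Generic.

Theorem theorem3 (R : realType) (omega : R)
  (homega : irrational omega)
  (hk : infinite_set [set k : nat |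
          odd k /\ (k`!)%:R <= `|multiplier omega ^+ k - 1|^-1])
  (Delta : R) (hDelta : 0 < Delta) :
  generic [set F : analytic_diffeo_space omega Delta |
             has_divergent_involution (series_of F)].
Proof.
exists (\bigcap_M large_coefficient M); split.
- exists (@large_coefficient R omega Delta) => // M.
  exact: large_coefficient_open.
- exact: large_coefficients_dense.
- by move=> F hF; apply: large_coefficients_divergent => // M; exact: hF.
Qed.
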